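(* Let $A\neq0$, let $M_A\subset\mathbb{R}^6$ be the $5$-dimensional submanifold of triples of points $(x_i,y_i)$, $i=1,2,3$, in the plane spanning a triangle of signed area $A$, let $$Z_i=(x_{i+1}-x_{i+2})\,\partial_{x_i}+(y_{i+1}-y_{i+2})\,\partial_{y_i},\qquad i=1,2,3\ (\text{indices mod }3),$$ and let $\mathcal{D}=\mathrm{Span}(Z_1-Z_2,Z_3-Z_1)$, a $(2,3,5)$ distribution on $M_A$. Then $\mathcal{D}$ is locally equivalent to the homogeneous $(2,3,5)$ distribution on the Lie group $\mathbf{SL}(2,\mathbb{R})\ltimes\mathbb{R}^2$ defined as the annihilator of the three Maurer–Cartan forms $$\theta^1=\tau^3-\tau^5,\qquad \theta^2=\tau^4+\tau^5,\qquad \theta^3=\tau^1-\tau^2-\tau^3,$$ where the forms $\tau^i$ are defined by $h^{-1}\,dh=\sum_{i=1}^6\tau^iE_i$, with $h$ the general element $$h=\begin{pmatrix} a & b & x \\ p & q & y \\ 0 & 0 & 1 \end{pmatrix},\qquad aq-bp=1,$$ of $\mathbf{SL}(2,\mathbb{R})\ltimes\mathbb{R}^2$, and $$E_1=\begin{pmatrix}0&1&0\\0&0&0\\0&0&0\end{pmatrix},\ E_2=\begin{pmatrix}0&0&0\\1&0&0\\0&0&0\end{pmatrix},\ E_3=\begin{pmatrix}1&0&0\\0&-1&0\\0&0&0\end{pmatrix},$$ $$E_4=\begin{pmatrix}0&0&1\\0&0&0\\0&0&0\end{pmatrix},\ E_5=\begin{pmatrix}0&0&0\\0&0&1\\0&0&0\end{pmatrix},\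 E_6=\begin{pmatrix}1&0&0\\0&1&0\\0&0&0\end{pmatrix}$$ (so that $\tau^6=0$ on $\mathbf{SL}(2,\mathbb{R})\ltimes\mathbb{R}^2$).
   Context: A point of $\mathbb{R}^6$ with coordinates $(x_1,y_1,x_2,y_2,x_3,y_3)$ encodes three points (''ants'') $\vec r_i=(x_i,y_i)$ in the plane; the signed area is $A=\tfrac12\sum_{i=1}^3(y_ix_{i+1}-x_iy_{i+1})$. The $Z_i$ span the velocity distribution of the rule ''the velocity $\dot{\vec r}_i$ is parallel to $\vec r_{i+1}-\vec r_{i+2}$'' (Rule B) and are tangent to every $M_A$. For a distribution put $\mathcal{D}^0=\mathcal D$, $\mathcal{D}^{I+1}=[\mathcal{D}^I,\mathcal{D}^I]+\mathcal{D}^I$; a rank $2$ distribution on a $5$-manifold is a $(2,3,5)$ distribution if $\mathcal{D},\mathcal{D}^1,\mathcal{D}^2$ have ranks $2,3,5$ at every point. Distributions $\mathcal{D}_1$ on $M_1$ and $\mathcal{D}_2$ on $M_2$ are locally equivalent if there is a local diffeomorphism $\phi:M_1\to M_2$ (defined near any given point of $M_1$) with $\phi_*\mathcal{D}_1=\mathcal{D}_2$. A distribution on a manifold is called homogeneous if its (local) symmetries act (locally) transitively on the manifold. *)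

(* Defs.v *)
From HB Require Import structures.
From mathcomp Require Import all_boot all_order all_algebra.
From mathcomp Require Import all_classical all_reals all_analysis.

Set Implicit Arguments.
Unset Strict Implicit.
Unset Printing Implicit Defensive.

Import Order.TTheory GRing.Theory Num.Theory.
Import numFieldNormedType.Exports.

Local Open Scope classical_set_scope.
Local Open Scope ring_scope.

Section Smooth.
Context {R : realType} {V W : normedModType R}.

(* The derivatives are taken direction by direction; for finite-dimensional V
   and open U this is the usual class C^k. *)
Fixpoint Ck (k : nat) (U : set V) (f : V -> W) : Prop :=
  if k is k'.+1 then
    (forall x, U x -> differentiable f x) /\
    (forall v, Ck k' U (fun x => 'd f x v))
  else forall x, U x -> {for x, continuous f}.

Definition smooth_on (U : set V) (f : V -> W) : Prop :=
  open U /\ forall k, Ck k U f.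

End Smooth.

Section LinearSpan.
Context {R : realType} {m n : nat}.
Local Notation V := 'M[R]_(m, n).

Definition vset (L : {vspace V}) : set V := [set v | v \in L].

Definition lspan (S : set V) : set V :=
  [set v | exists s : seq V, (forall w, w \in s -> S w) /\ v \in span s].

Definition has_rank (S : set V) (k : nat) : Prop :=
  exists L : {vspace V}, S = vset L /\ \dim L = k.

End LinearSpan.

(* All manifolds are embedded in a matrix space 'M[R]_(m, n); R^k is 'rV_k.
   Maps and vector fields on a submanifold are smooth when they are
   restrictions of smooth maps defined on an open subset of the ambient space.
   A distribution is given pointwise, by subsets of the ambient space; only its
   values at points of the submanifold are ever used. *)
Section Distributions.
Context {R : realType} {m n : nat}.
Local Notation V := 'M[R]_(m, n).
Implicit Types (M U : set V) (D : V -> set V) (X Y : V -> V) (p q v : V).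

(* M is locally the zero set of a submersion onto R^c, with d + c = dim V. *)
Definition submanifold (d : nat) M : Prop :=
  forall p, M p -> exists (c : nat) U (F : V -> 'rV[R]_c),
    [/\ (d + c = m * n)%N, U p, smooth_on U F,
        (forall q, U q -> forall w, exists v, 'd F q v = w)
      & forall q, U q -> (M q <-> F q = 0)].

(* Velocities at p of smooth curves in M. *)
Definition tangent M p : set V :=
  [set v | exists (I : set R) (gamma : R -> V),
     [/\ I 0, smooth_on I gamma, (forall t, I t -> M (gamma t)),
         gamma 0 = p & derive1 gamma 0 = v]].

Definition is_distribution M (k : nat) D : Prop :=
  (forall p, M p -> D p `<=` tangent M p) /\
  (forall p, M p -> exists U (X : 'I_k -> V -> V),
     [/\ U p, (forall i, smooth_on U (X i))
       & forall q, M q -> U q ->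
           free [seq X i q | i : 'I_k] /\
           D q = vset (span [seq X i q | i : 'I_k])]).

Definition local_section M D p X : Prop :=
  exists U, [/\ U p, smooth_on U X & forall q, M q -> U q -> D q (X q)].

(* For X, Y tangent to M this is the bracket of their restrictions to M, and
   does not depend on the extensions to the ambient space. *)
Definition lie_bracket X Y p : V := 'd Y p (X p) - 'd X p (Y p).

Definition derived M D : V -> set V := fun p =>
  lspan (D p `|` [set v | exists X Y,
    [/\ local_section M D p X, local_section M D p Y & v = lie_bracket X Y p]]).

Definition derived_flag M D (I : nat) : V -> set V := iter I (derived M) D.

Definition is_235 M D : Prop :=
  [/\ submanifold 5 M, is_distribution M 2 D
    & forall p, M p ->
        [/\ has_rank (derived_flag M D 0 p) 2,
            has_rank (derived_flag M D 1 p) 3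
          & has_rank (derived_flag M D 2 p) 5]].

End Distributions.

Section Equivalence.
Context {R : realType} {m n m' n' : nat}.
Local Notation V := 'M[R]_(m, n).
Local Notation W := 'M[R]_(m', n').

(* A diffeomorphism phi, with inverse psi, from a neighbourhood of p in M1 onto
   a neighbourhood of q in M2, with phi p = q and phi_* D1 = D2. *)
Definition equivalent_at (M1 : set V) (D1 : V -> set V)
    (M2 : set W) (D2 : W -> set W) (p : V) (q : W) : Prop :=
  exists (U : set V) (O : set W) (phi : V -> W) (psi : W -> V),
    [/\ U p, phi p = q, smooth_on U phi & smooth_on O psi] /\
    [/\ (forall x, M1 x -> U x -> [/\ M2 (phi x), O (phi x) & psi (phi x) = x]),
        (forall y, M2 y -> O y -> [/\ M1 (psi y), U (psi y) & phi (psi y) = y])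
      & forall x, M1 x -> U x -> [set 'd phi x v | v in D1 x] = D2 (phi x)].

Definition locally_equivalent (M1 : set V) (D1 : V -> set V)
    (M2 : set W) (D2 : W -> set W) : Prop :=
  forall p, M1 p -> exists q, M2 q /\ equivalent_at M1 D1 M2 D2 p q.

End Equivalence.

Definition homogeneous {R : realType} {m n : nat}
    (M : set 'M[R]_(m, n)) (D : 'M[R]_(m, n) -> set 'M[R]_(m, n)) : Prop :=
  forall p q, M p -> M q -> equivalent_at M D M D p q.

(* Three points of the plane, (x_1, y_1, x_2, y_2, x_3, y_3) : R^6. The labels
   1, 2, 3 of the points are 0, 1, 2 : 'I_3, whose addition is modulo 3. *)
Section Triangles.
Context {R : realType}.
Implicit Types (r : 'rV[R]_6) (i : 'I_3).

Definition xidx i : 'I_6 := inord i.*2.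
Definition yidx i : 'I_6 := inord i.*2.+1.

Definition xc r i : R := r 0 (xidx i).
Definition yc r i : R := r 0 (yidx i).

Definition signed_area r : R :=
  2^-1 * \sum_(i < 3) (yc r i * xc r (i + 1) - xc r i * yc r (i + 1)).

Definition triangles (A : R) : set 'rV[R]_6 := [set r | signed_area r = A].

Definition Z i r : 'rV[R]_6 :=
  (xc r (i + 1) - xc r (i + 2)) *: delta_mx 0 (xidx i) +
  (yc r (i + 1) - yc r (i + 2)) *: delta_mx 0 (yidx i).

Definition ant_distribution r : set 'rV[R]_6 :=
  vset (span [:: Z 0 r - Z 1 r; Z 2 r - Z 0 r]).

End Triangles.

Section SpecialAffineGroup.
Context {R : realType}.
Implicit Types (h X : 'M[R]_3).

(* SL(2,R) |x R^2 *)
Definition SL2R2 : set 'M[R]_3 :=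
  [set h | [/\ h 2 0 = 0, h 2 1 = 0, h 2 2 = 1
             & h 0 0 * h 1 1 - h 0 1 * h 1 0 = 1]].

Definition E_basis : 6.-tuple 'M[R]_3 :=
  [tuple delta_mx 0 1;
         delta_mx 1 0;
         delta_mx 0 0 - delta_mx 1 1;
         delta_mx 0 2;
         delta_mx 1 2;
         delta_mx 0 0 + delta_mx 1 1].

(* tau k is the form tau^k, 1 <= k <= 6 (numbered from 1), at h, evaluated on
   the ambient vector X: the coordinate of h^-1 X along E_k. It is meaningful
   for X tangent to SL2R2, as then h^-1 X lies in the span of the E_k. *)
Definition tau (k : nat) h X : R :=
  coord E_basis (inord k.-1) (invmx h *m X).

Definition theta1 h X : R := tau 3 h X - tau 5 h X.
Definition theta2 h X : R := tau 4 h X + tau 5 h X.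
Definition theta3 h X : R := tau 1 h X - tau 2 h X - tau 3 h X.

Definition MC_distribution h : set 'M[R]_3 :=
  [set X | [/\ tangent SL2R2 h X, theta1 h X = 0, theta2 h X = 0
             & theta3 h X = 0]].

End SpecialAffineGroup.

(* Main.v *)
(* The group SL(2,R) |x R^2 acts simply transitively on the triangles of signed area A
   and preserves the ant distribution. The affine map sending (r_1, r_2, r_3) to the
   matrix with columns r_1 - r_3, r_2 - r_3 and r_3, with first coordinates divided by
   -2A, identifies the triangles with the group; under it Z_1 - Z_2 and Z_3 - Z_1 become
   the left-invariant fields h (E_1 + E_2) and - h (E_1 + E_3 - E_4 + E_5), which span
   the Maurer-Cartan distribution. For a left-invariant distribution h L the derived
   distribution is h (L + [L, L]), so the derived flag is computed in the Lie algebra;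
   it is carried over to the triangles by the affine map. *)

From HB Require Import structures.
Require Import Defs.
From mathcomp Require Import all_boot all_order all_algebra.
From mathcomp Require Import all_classical all_reals all_analysis.
From mathcomp Require Import ring lra.

Set Implicit Arguments.
Unset Strict Implicit.
Unset Printing Implicit Defensive.

Import Order.TTheory GRing.Theory Num.Theory.
Import numFieldNormedType.Exports.

Local Open Scope classical_set_scope.
Local Open Scope ring_scope.

Section Calculus.
Context {R : realType}.
Implicit Types U V W : normedModType R.

Lemma continuous_sum (T : topologicalType) W (I : Type) (r : seq I) (f : I -> T -> W) :
  (forall i, continuous (f i)) -> continuous (fun x => \sum_(i <- r) f i x).
Proof.
move=> fc x; apply: (@cvg_big _ _ +%R 0 xpredT _ _ (nbhs x)) => [|i _].
  exact: add_continuous.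
exact: fc.
Qed.

Lemma mx_linear_continuous m n W (f : {linear 'M[R]_(m, n) -> W}) : continuous f.
Proof.
have -> : (f : _ -> _) = fun M => \sum_(i < m) \sum_(j < n) M i j *: f (delta_mx i j).
  apply/funext => M; rewrite {1}[M]matrix_sum_delta linear_sum.
  by apply: eq_bigr => i _; rewrite linear_sum; apply: eq_bigr => j _; rewrite linearZ.
do 2!apply: continuous_sum => ?.
by move=> M; apply: (@cvgZr_tmp _ _ _ (nbhs M)); exact: coord_continuous.
Qed.

Lemma mulmx_continuous m n p :
  continuous (fun q : 'M[R]_(m, n) * 'M[R]_(n, p) => q.1 *m q.2).
Proof.
have -> : (fun q : 'M[R]_(m, n) * 'M[R]_(n, p) => q.1 *m q.2) =
    fun q => \sum_(i < m) \sum_(k < p) \sum_(j < n) (q.1 i j * q.2 j k) *: delta_mx i k.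
  apply/funext => q; rewrite {1}[q.1 *m q.2]matrix_sum_delta.
  apply: eq_bigr => i _; apply: eq_bigr => k _; rewrite mxE scaler_suml.
  by [].
apply: continuous_sum => i; apply: continuous_sum => k; apply: continuous_sum => j q.
apply: (@cvgZr_tmp _ _ _ (nbhs q)); apply: (@cvgM _ _ (nbhs q)).
  apply: (@continuous_comp _ _ _ fst (fun M : 'M[R]_(m, n) => M i j)); first exact: cvg_fst.
  exact: coord_continuous.
apply: (@continuous_comp _ _ _ snd (fun M : 'M[R]_(n, p) => M j k)); first exact: cvg_snd.
exact: coord_continuous.
Qed.

Lemma near_eq_is_diff V W (f g df : V -> W) x :
  (\forall y \near x, f y = g y) -> is_diff x f df -> is_diff x g df.
Proof.
move=> fg [fd <-].
have fgx : f x = g x by exact: (nbhs_singleton fg).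
have e : g \o shift x = cst (g x) + 'd f x +o_ (0 : V) id.
  apply/eqaddoP => e e0.
  have /eqaddoP /(_ _ e0) := diff_locally fd.
  have /nbhs0P := fg.
  apply: filterS2 => y /= fgy.
  by rewrite !fctE /= [y + x]addrC -fgy fgx.
have dc : continuous ('d f x) by exact: diff_continuous.
have dg : 'd g x = 'd f x :> (V -> W) by exact: (diff_unique dc e).
by apply: DiffDef => //; apply/diff_locallyP; rewrite dg; split.
Qed.

Lemma diff_eq_on V W (O : set V) (f g : V -> W) x :
  open O -> (forall y, O y -> f y = g y) -> O x -> differentiable f x ->
  differentiable g x /\ 'd g x = 'd f x :> (V -> W).
Proof.
move=> oO fg Ox df.
have [] : is_diff x g ('d f x).
  apply: near_eq_is_diff (differentiableP df).
  by near=> y; apply: fg; near: y; exact: open_nbhs_nbhs.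
by [].
Unshelve. all: by end_near. Qed.

Lemma Ck_eq V W k (O : set V) (f g : V -> W) :
  open O -> (forall y, O y -> f y = g y) -> Ck k O f -> Ck k O g.
Proof.
move=> oO; elim: k f g => [|k IH] f g fg /=.
  move=> fc x Ox; have fgx := fg x Ox.
  rewrite /prop_for /continuous_at -fgx.
  apply: cvg_trans (fc x Ox); apply: near_eq_cvg.
  by near=> y; apply: fg; near: y; exact: open_nbhs_nbhs.
move=> [df ddf]; split=> [x Ox|v].
  by have [] := diff_eq_on oO fg Ox (df x Ox).
apply: IH (ddf v) => y Oy.
by have [_ ->] := diff_eq_on oO fg Oy (df y Oy).
Unshelve. all: by end_near. Qed.

Lemma CkS V W k (O : set V) (f : V -> W) : Ck k.+1 O f -> Ck k O f.
Proof.
elim: k f => [|k IH] f [df ddf].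
  by move=> x Ox; apply: differentiable_continuous; exact: df.
by split=> // v; apply: IH; exact: ddf.
Qed.

Lemma Ck_cst V W k (O : set V) (c : W) : Ck k O (fun _ => c).
Proof.
elim: k c => [|k IH] c; first by move=> x _; exact: cst_continuous.
split=> [x _|v]; first exact: differentiable_cst.
have -> : (fun x => 'd (fun _ : V => c) x v) = fun _ => 0 by apply/funext => x; rewrite diff_cst.
exact: IH.
Qed.

Lemma Ck_lin V W k (O : set V) (f : {linear V -> W}) : continuous f -> Ck k O f.
Proof.
move=> fc; case: k => [|k]; first by move=> x _; exact: fc.
split=> [x _|v]; first exact: linear_differentiable.
have -> : (fun x => 'd f x v) = fun _ => f v by apply/funext => x; rewrite diff_lin.
exact: Ck_cst.
Qed.

Lemma CkD V W k (O : set V) (f g : V -> W) :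
  open O -> Ck k O f -> Ck k O g -> Ck k O (f + g).
Proof.
move=> oO; elim: k f g => [|k IH] f g.
  by move=> fc gc x Ox; apply: (@cvgD _ _ _ (nbhs x)); [exact: fc|exact: gc].
move=> [df ddf] [dg ddg]; split=> [x Ox|v].
  by apply: differentiableD; [exact: df|exact: dg].
apply: Ck_eq (IH _ _ (ddf v) (ddg v)) => // y Oy.
by rewrite (diffD (df y Oy) (dg y Oy)).
Qed.

Lemma Ck_comp_lin U V W k (O : set U) (f : {linear V -> W}) (g : U -> V) :
  open O -> continuous f -> Ck k O g -> Ck k O (f \o g).
Proof.
move=> oO fc; elim: k g => [|k IH] g.
  by move=> gc x Ox; apply: continuous_comp; [exact: gc|exact: fc].
move=> [dg ddg]; split=> [x Ox|v].
  by apply: differentiable_comp; [exact: dg|exact: linear_differentiable].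
apply: Ck_eq (IH _ (ddg v)) => // y Oy.
by rewrite (diff_comp (dg y Oy) (linear_differentiable _ fc)) /= diff_lin.
Qed.

Lemma Ck_precomp U V W k (O : set V) (g : V -> W) (f df : U -> V) :
  open O -> continuous f -> (forall x, is_diff x f df) -> Ck k O g ->
  Ck k (f @^-1` O) (g \o f).
Proof.
move=> oO fc fd; elim: k g => [|k IH] g.
  by move=> gc x Ox; apply: continuous_comp; [exact: fc|exact: gc].
have fd' x : differentiable f x by case: (fd x).
have fE x : 'd f x = df :> (U -> V) by case: (fd x).
move=> [dg ddg]; split=> [x Ox|v].
  by apply: differentiable_comp => //; exact: dg.
have oO' : open (f @^-1` O) by apply: open_comp => // x _; exact: fc.
apply: Ck_eq (IH _ (ddg (df v))) => // y Oy.
by rewrite (diff_comp (fd' y) (dg _ Oy)) /= fE.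
Qed.

Lemma diff_bilin_comp U V V' W (f : {bilinear V -> V' -> W}) (a : U -> V) (b : U -> V') x :
  continuous (fun p : V * V' => f p.1 p.2) -> differentiable a x -> differentiable b x ->
  differentiable (fun y => f (a y) (b y)) x /\
  forall v, 'd (fun y => f (a y) (b y)) x v = f ('d a x v) (b x) + f (a x) ('d b x v).
Proof.
move=> fc da db.
have -> : (fun y => f (a y) (b y)) = (fun p : V * V' => f p.1 p.2) \o (fun y => (a y, b y)) by [].
have dab := differentiable_pair da db.
have df := differentiable_bilin (a x, b x) fc.
split; first exact: differentiable_comp.
move=> v; rewrite (diff_comp dab df) /= (diff_bilin _ fc) (diff_pair da db) /=.
by rewrite addrC.
Qed.

Lemma Ck_bilin U V V' W k (O : set U) (f : {bilinear V -> V' -> W}) (a : U -> V) (b : U -> V') :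
  open O -> continuous (fun p : V * V' => f p.1 p.2) ->
  Ck k O a -> Ck k O b -> Ck k O (fun y => f (a y) (b y)).
Proof.
move=> oO fc; elim: k a b => [|k IH] a b.
  move=> ac bc x Ox.
  apply: (@continuous_comp _ _ _ (fun y => (a y, b y)) (fun p : V * V' => f p.1 p.2)).
    by apply: (@cvg_pair _ _ _ (nbhs x)); [exact: ac|exact: bc].
  exact: fc.
move=> Ca Cb; have [da dda] := Ca; have [db ddb] := Cb; split=> [x Ox|v].
  by have [] := diff_bilin_comp fc (da x Ox) (db x Ox).
have C1 := IH _ _ (dda v) (CkS Cb).
have C2 := IH _ _ (CkS Ca) (ddb v).
apply: Ck_eq (CkD oO C1 C2) => // y Oy.
by have [_ ->] := diff_bilin_comp fc (da y Oy) (db y Oy).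
Qed.

End Calculus.

Section SmoothMatrixMaps.
Context {R : realType}.

Lemma smooth_affine m n m' n' (f : {linear 'M[R]_(m, n) -> 'M[R]_(m', n')}) c :
  smooth_on setT (fun x => f x + c).
Proof.
split=> [|k]; first exact: openT.
apply: (CkD openT (f := f) (g := fun=> c)); last exact: Ck_cst.
exact/Ck_lin/mx_linear_continuous.
Qed.

Lemma smooth_line m n (N c : 'M[R]_(m, n)) : smooth_on setT (fun t : R => t *: N + c).
Proof.
split=> [|k]; first exact: openT.
have lin : linear ( *:%R ^~ N : R -> _) by move=> u y z; rewrite scalerDl scalerA.
pose lM := GRing.isLinear.Build _ _ _ _ _ lin.
pose l : {linear _ -> _} := HB.pack ( *:%R ^~ N : R -> _) lM.
apply: (CkD openT (f := l) (g := fun=> c)); last exact: Ck_cst.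
by apply: Ck_lin; exact: scalel_continuous.
Qed.

Lemma smooth_mulmx (V : normedModType R) m n p (O : set V)
    (A : V -> 'M[R]_(m, n)) (B : V -> 'M[R]_(n, p)) :
  smooth_on O A -> smooth_on O B -> smooth_on O (fun x => A x *m B x).
Proof.
move=> [oO CA] [_ CB]; split=> // k.
by apply: (Ck_bilin (f := @mulmx R m n p)) => //; exact: mulmx_continuous.
Qed.

Lemma diff_mulmx (V : normedModType R) m n p (x : V)
    (A : V -> 'M[R]_(m, n)) (B : V -> 'M[R]_(n, p)) :
  differentiable A x -> differentiable B x ->
  differentiable (fun y => A y *m B y) x /\
  forall v, 'd (fun y => A y *m B y) x v = 'd A x v *m B x + A x *m 'd B x v.
Proof. exact: (diff_bilin_comp (f := @mulmx R m n p) (@mulmx_continuous R m n p)). Qed.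

Lemma diff_mx_lin m n m' n' (f : {linear 'M[R]_(m, n) -> 'M[R]_(m', n')}) x :
  'd f x = f :> (_ -> _).
Proof. by apply: diff_lin; exact: mx_linear_continuous. Qed.

Lemma is_diff_affine m n m' n' (f : {linear 'M[R]_(m, n) -> 'M[R]_(m', n')}) c x :
  is_diff x (fun y => f y + c) f.
Proof.
have fd : differentiable f x by exact/linear_differentiable/mx_linear_continuous.
have fD : is_diff x f f by apply: DiffDef => //; exact: diff_mx_lin.
have /is_diff_eq := is_diffD fD (is_diff_cst c x); apply.
by apply/funext => v /=; rewrite addr0.
Qed.

Lemma smooth_comp_affine (V : normedModType R) m n m' n' (O : set V)
    (f : {linear 'M[R]_(m, n) -> 'M[R]_(m', n')}) c (g : V -> 'M[R]_(m, n)) :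
  smooth_on O g -> smooth_on O (fun x => f (g x) + c).
Proof.
move=> [oO Cg]; split=> // k.
apply: (CkD oO (f := f \o g) (g := fun=> c)); last exact: Ck_cst.
by apply: Ck_comp_lin => //; exact: mx_linear_continuous.
Qed.

Lemma smooth_differentiable (V W : normedModType R) (O : set V) (f : V -> W) x :
  smooth_on O f -> O x -> differentiable f x.
Proof. by move=> [_ /(_ 1%N) [df _]] /df. Qed.

End SmoothMatrixMaps.

Section Matrices3.
Context {R : comPzRingType}.
Implicit Types A B : 'M[R]_3.

Lemma sum3 (F : 'I_3 -> R) : \sum_i F i = F 0 + F 1 + F 2.
Proof.
rewrite !big_ord_recl big_ord0 addr0 addrA.
by congr (F _ + F _ + F _); apply/val_inj.
Qed.

Lemma mulmx3E A B i j :
  (A *m B) i j = A i 0 * B 0 j + A i 1 * B 1 j + A i 2 * B 2 j.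
Proof. by rewrite mxE sum3. Qed.

Lemma ord3P (P : 'I_3 -> Prop) : P 0 -> P 1 -> P 2 -> forall i, P i.
Proof.
move=> P0 P1 P2 [[|[|[|//]]] lti].
- by have -> : Ordinal lti = 0 by exact/val_inj.
- by have -> : Ordinal lti = 1 by exact/val_inj.
- by have -> : Ordinal lti = 2 by exact/val_inj.
Qed.

End Matrices3.

Section LieAlgebra.
Context {R : realType}.
Implicit Types (K : 'M[R]_3) (a b c d e : R).

(* Locked, as unification would otherwise unfold it against other matrices. *)
Definition aff a b c d e : 'M[R]_3 :=
  locked (a *: delta_mx 0 1 + b *: delta_mx 1 0 + c *: (delta_mx 0 0 - delta_mx 1 1)
  + d *: delta_mx 0 2 + e *: delta_mx 1 2).

Lemma affE a b c d e :
  [/\ aff a b c d e 0 0 = c, aff a b c d e 0 1 = a & aff a b c d e 0 2 = d] /\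
  [/\ aff a b c d e 1 0 = b, aff a b c d e 1 1 = - c & aff a b c d e 1 2 = e] /\
  [/\ aff a b c d e 2 0 = 0, aff a b c d e 2 1 = 0 & aff a b c d e 2 2 = 0].
Proof. by rewrite /aff -lock; do !split; rewrite !mxE /=; ring. Qed.

Lemma eq_aff a b c d e a' b' c' d' e' :
  a = a' -> b = b' -> c = c' -> d = d' -> e = e' -> aff a b c d e = aff a' b' c' d' e'.
Proof. by do 5!move=> ->. Qed.

Lemma affD a b c d e a' b' c' d' e' : aff a b c d e + aff a' b' c' d' e' =
  aff (a + a') (b + b') (c + c') (d + d') (e + e').
Proof. by rewrite /aff -!lock; apply/matrixP => i j; rewrite !mxE; ring. Qed.

Lemma affZ k a b c d e : k *: aff a b c d e = aff (k * a) (k * b) (k * c) (k * d) (k * e).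
Proof. by rewrite /aff -!lock; apply/matrixP => i j; rewrite !mxE; ring. Qed.

Lemma aff_inj a b c d e a' b' c' d' e' : aff a b c d e = aff a' b' c' d' e' ->
  [/\ a = a', b = b', c = c', d = d' & e = e'].
Proof.
move=> E; have [[m00 m01 m02] [[m10 m11 m12] _]] := affE a b c d e.
have [[n00 n01 n02] [[n10 n11 n12] _]] := affE a' b' c' d' e'.
by split; congruence.
Qed.

Lemma aff0 : aff 0 0 0 0 0 = 0 :> 'M[R]_3.
Proof. by rewrite /aff -!lock; apply/matrixP => i j; rewrite !mxE; ring. Qed.

Definition sl2r2 K :=
  [/\ K 2 0 = 0, K 2 1 = 0, K 2 2 = 0 & K 1 1 = - K 0 0].

Lemma sl2r2P K : sl2r2 K <-> K = aff (K 0 1) (K 1 0) (K 0 0) (K 0 2) (K 1 2).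
Proof.
split=> [[k20 k21 k22 k11]|->].
  have := affE (K 0 1) (K 1 0) (K 0 0) (K 0 2) (K 1 2).
  set M := aff _ _ _ _ _ => -[[m00 m01 m02] [[m10 m11 m12] [m20 m21 m22]]].
  by apply/matrixP; do 2!elim/ord3P; congruence.
have [[m00 m01 m02] [[m10 m11 m12] [m20 m21 m22]]] :=
  affE (K 0 1) (K 1 0) (K 0 0) (K 0 2) (K 1 2).
by split => //; congruence.
Qed.

Lemma sl2r2_aff a b c d e : sl2r2 (aff a b c d e).
Proof. by have [[? ? ?] [[? ? ?] [? ? ?]]] := affE a b c d e; split=> //; congruence. Qed.

End LieAlgebra.

Section Group.
Context {R : realType}.
Implicit Types (h g K : 'M[R]_3).

Lemma SL2R2_mul h g : SL2R2 h -> SL2R2 g -> SL2R2 (h *m g).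
Proof.
move=> [h20 h21 h22 dh] [g20 g21 g22 dg].
split; rewrite !mulmx3E ?h20 ?h21 ?h22 ?g20 ?g21 ?g22; try ring.
have -> : (1 : R) = (h 0 0 * h 1 1 - h 0 1 * h 1 0) * (g 0 0 * g 1 1 - g 0 1 * g 1 0).
  by rewrite dh dg mulr1.
by ring.
Qed.

Lemma SL2R2_unit h : SL2R2 h -> h \in unitmx.
Proof.
move=> [h20 h21 h22 dh].
pose g : 'M[R]_3 := aff (- h 0 1) (- h 1 0) (h 1 1) (h 0 1 * h 1 2 - h 0 2 * h 1 1)
  (h 1 0 * h 0 2 - h 0 0 * h 1 2) + (h 0 0 + h 1 1) *: delta_mx 1 1 + delta_mx 2 2.
suff /mulmx1_unit [] : h *m g = 1%:M by [].
have dh' : h 0 0 * h 1 1 = 1 + h 0 1 * h 1 0 by rewrite -dh; ring.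
apply/matrixP; do 2!elim/ord3P; rewrite mulmx3E /g /aff -!lock !mxE /= ?h20 ?h21 ?h22.
all: by ring: dh'.
Qed.

Lemma SL2R2_inv h : SL2R2 h -> SL2R2 (invmx h).
Proof.
move=> hG; have uh := SL2R2_unit hG; move: hG => [h20 h21 h22 dh].
have e i j : (h *m invmx h) i j = (i == j)%:R by rewrite mulmxV // mxE.
set g := invmx h in e *.
have := e 2 0; rewrite mulmx3E h20 h21 h22 !mul0r !add0r mul1r => /= g20.
have := e 2 1; rewrite mulmx3E h20 h21 h22 !mul0r !add0r mul1r => /= g21.
have := e 2 2; rewrite mulmx3E h20 h21 h22 !mul0r !add0r mul1r => /= g22.
split => //.
have := e 0 0; rewrite mulmx3E g20 mulr0 addr0 => /= e00.
have := e 0 1; rewrite mulmx3E g21 mulr0 addr0 => /= e01.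
have := e 1 0; rewrite mulmx3E g20 mulr0 addr0 => /= e10.
have := e 1 1; rewrite mulmx3E g21 mulr0 addr0 => /= e11.
transitivity ((h 0 0 * g 0 0 + h 0 1 * g 1 0) * (h 1 0 * g 0 1 + h 1 1 * g 1 1) -
  (h 0 0 * g 0 1 + h 0 1 * g 1 1) * (h 1 0 * g 0 0 + h 1 1 * g 1 0)).
  transitivity ((h 0 0 * h 1 1 - h 0 1 * h 1 0) * (g 0 0 * g 1 1 - g 0 1 * g 1 0)).
    by rewrite dh mul1r.
  by ring.
by rewrite e00 e01 e10 e11; ring.
Qed.

Definition flow K (gamma delta : R -> 'M[R]_3) : Prop :=
  [/\ smooth_on setT gamma, smooth_on setT delta,
      gamma 0 = 1%:M /\ delta 0 = 1%:M,
      'd gamma 0 1 = K /\ 'd delta 0 1 = - K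
    & forall t, delta t *m gamma t = 1%:M /\ SL2R2 (gamma t)].

Lemma diff_line m n (N c : 'M[R]_(m, n)) (x : R) : 'd (fun t : R => t *: N + c) x 1 = N.
Proof.
have [_ e] := is_diffD (is_diff_scalel x N) (is_diff_cst c x).
rewrite (_ : (fun t : R => t *: N + c) = *:%R ^~ N + cst c) // e.
by rewrite fctE scale1r addr0.
Qed.

Lemma flow_nilpotent K : sl2r2 K -> K *m K = 0 -> exists gamma delta, flow K gamma delta.
Proof.
move=> [k20 k21 k22 k11] KK.
exists (fun t => t *: K + 1%:M), (fun t => t *: (- K) + 1%:M).
split; [exact: smooth_line|exact: smooth_line|by rewrite !scale0r !add0r|by split; exact: diff_line|].
move=> t; split.
  by rewrite mulmxDl !mulmxDr !mulmx1 mul1mx -scalemxAl -scalemxAr mulNmx KK oppr0 !scaler0 add0r addrA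
    scalerN addNr add0r.
have e : (K *m K) 0 0 = 0 by rewrite KK mxE.
rewrite mulmx3E k20 in e.
split; rewrite !mxE /= ?k20 ?k21 ?k22 ?k11; try ring.
transitivity (1 - t ^+ 2 * (K 0 0 * K 0 0 + K 0 1 * K 1 0 + K 0 2 * 0)); first by ring.
by rewrite e; ring.
Qed.

Lemma flowD K K' gamma delta gamma' delta' :
  flow K gamma delta -> flow K' gamma' delta' ->
  flow (K + K') (fun t => gamma t *m gamma' t) (fun t => delta' t *m delta t).
Proof.
move=> [sg sd [g0 d0] [dg dd] H] [sg' sd' [g0' d0'] [dg' dd'] H'].
have D (f : R -> 'M[R]_3) : smooth_on setT f -> differentiable f (0 : R).
  by move=> sf; exact: (smooth_differentiable sf).
split; [exact: smooth_mulmx|exact: smooth_mulmx|by rewrite g0 d0 g0' d0' !mulmx1| |].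
  have [_ e1] := diff_mulmx (D gamma sg) (D gamma' sg').
  have [_ e2] := diff_mulmx (D delta' sd') (D delta sd).
  split.
    transitivity (K *m 1%:M + 1%:M *m K'); last by rewrite mulmx1 mul1mx.
    by apply: etrans (e1 1) _; apply: f_equal2; apply: f_equal2.
  transitivity ((- K') *m 1%:M + 1%:M *m (- K)); last by rewrite mulmx1 mul1mx opprD addrC.
  by apply: etrans (e2 1) _; apply: f_equal2; apply: f_equal2.
move=> t; have [e1 G1] := H t; have [e2 G2] := H' t; split; last exact: SL2R2_mul.
by rewrite mulmxA -(mulmxA (delta' t)) e1 mulmx1 e2.
Qed.

(* sl(2) is spanned by square-zero matrices, and so is sl(2) |x R^2. *)
Lemma flow_exists K : sl2r2 K -> exists gamma delta, flow K gamma delta.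
Proof.
move=> /sl2r2P ->; set a := K 0 1; set b := K 1 0; set c := K 0 0.
set d := K 0 2; set e := K 1 2.
have nil a' b' c' d' e' : c' * c' + a' * b' = 0 -> c' * d' + a' * e' = 0 ->
    b' * d' - c' * e' = 0 -> exists gamma delta, flow (aff a' b' c' d' e') gamma delta.
  move=> h1 h2 h3; apply: flow_nilpotent; first exact: sl2r2_aff.
  have [[m00 m01 m02] [[m10 m11 m12] [m20 m21 m22]]] := affE a' b' c' d' e'.
  apply/matrixP; do 2!elim/ord3P; rewrite mulmx3E [RHS]mxE
    ?(m00, m01, m02, m10, m11, m12, m20, m21, m22); try ring.
  - by rewrite -[RHS]h1; ring.
  - by rewrite -[RHS]h2; ring.
  - by rewrite -[RHS]h1; ring.
  - by rewrite -[RHS]h3; ring.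
have -> : aff a b c d e = aff (- c) c c 0 0 + aff (a + c) 0 0 0 0 + aff 0 (b - c) 0 0 0 + aff 0 0 0 d e.
  by rewrite !affD; apply: eq_aff; ring.
have [g1 [d1 f1]] : exists gamma delta, flow (aff (- c) c c 0 0) gamma delta by apply: nil; ring.
have [g2 [d2 f2]] : exists gamma delta, flow (aff (a + c) 0 0 0 0) gamma delta by apply: nil; ring.
have [g3 [d3 f3]] : exists gamma delta, flow (aff 0 (b - c) 0 0 0) gamma delta by apply: nil; ring.
have [g4 [d4 f4]] : exists gamma delta, flow (aff 0 0 0 d e) gamma delta by apply: nil; ring.
eexists; eexists; exact: flowD (flowD (flowD f1 f2) f3) f4.
Qed.

End Group.

Section Quadratic.
Context {R : realType}.

Definition mxcoord m n (i : 'I_m) (j : 'I_n) (M : 'M[R]_(m, n)) : R := M i j.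

Fact mxcoord_is_linear m n i j : linear (@mxcoord m n i j).
Proof. by move=> a M N; rewrite /mxcoord !mxE. Qed.

HB.instance Definition _ m n i j :=
  GRing.isLinear.Build R 'M[R]_(m, n) R _ (@mxcoord m n i j) (@mxcoord_is_linear m n i j).

Lemma Ck_mxcoordM m n i j i' j' k (O : set 'M[R]_(m, n)) :
  open O -> Ck k O (fun M => M i j * M i' j').
Proof.
move=> oO; apply: (Ck_bilin (f := @GRing.mul R) (a := mxcoord i j) (b := mxcoord i' j')) => //.
- by move=> p; exact: mul_continuous.
- exact/Ck_lin/mx_linear_continuous.
- exact/Ck_lin/mx_linear_continuous.
Qed.

Lemma is_diff_mxcoordM m n i j i' j' (M : 'M[R]_(m, n)) :
  is_diff M (fun M => M i j * M i' j') (fun N => N i j * M i' j' + M i j * N i' j').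
Proof.
have dc k l : differentiable (mxcoord k l) M.
  exact/linear_differentiable/mx_linear_continuous.
have mc : continuous (fun p : R * R => p.1 * p.2) by move=> p; exact: mul_continuous.
have [d e] := diff_bilin_comp (f := @GRing.mul R) mc (dc i j) (dc i' j').
apply: DiffDef => //; apply/funext => N; apply: etrans (e N) _.
have cE k l : 'd (mxcoord k l) M N = N k l.
  have /(congr1 (fun f => f N)) := diff_lin M (@mx_linear_continuous _ _ _ _ (mxcoord k l)).
  exact.
by apply: f_equal2; apply: f_equal2.
Qed.

Definition det2 (h : 'M[R]_3) : R := h 0 0 * h 1 1 - h 0 1 * h 1 0.

Lemma is_diff_det2 h : is_diff h det2 (fun v =>
  (v 0 0 * h 1 1 + h 0 0 * v 1 1) - (v 0 1 * h 1 0 + h 0 1 * v 1 0)).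
Proof. exact: (is_diffB (is_diff_mxcoordM 0 0 1 1 h) (is_diff_mxcoordM 0 1 1 0 h)). Qed.

Lemma diff_curve_cst (V W : normedModType R) (c : R -> V) (G : V -> W) (t : R) w :
  differentiable c t -> differentiable G (c t) -> (\forall s \near t, G (c s) = w) ->
  'd G (c t) ('d c t 1) = 0.
Proof.
move=> dc dG Gw.
have /(congr1 (fun f => f 1)) /= <- := diff_comp dc dG.
have [_ ->] // : is_diff t (G \o c) (fun=> 0).
apply: (near_eq_is_diff _ (is_diff_cst w t)).
by apply: filterS Gw => s /= ->.
Qed.

End Quadratic.

Section LeftInvariant.
Context {R : realType}.
Implicit Types (h p q K X : 'M[R]_3) (L : {vspace 'M[R]_3}).

Definition lmulset h (S : 'M[R]_3 -> Prop) : set 'M[R]_3 :=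
  [set X | exists2 K, S K & X = h *m K].

Lemma derive1_diff (V : normedModType R) (c : R -> V) (t : R) :
  differentiable c t -> derive1 c t = 'd c t 1.
Proof. by move=> dc; rewrite derive1E'. Qed.

Lemma diff_mulmx_curve h (c : R -> 'M[R]_3) (t : R) : differentiable c t ->
  'd (fun s => h *m c s) t 1 = h *m 'd c t 1.
Proof.
move=> dc; have dh : differentiable (mulmx h : _ -> 'M[R]_3) (c t).
  exact/linear_differentiable/mx_linear_continuous.
have /(congr1 (fun f => f 1)) e := diff_comp dc dh.
apply: etrans e _ => /=.
exact: (congr1 (fun f => f _) (diff_mx_lin (mulmx h : {linear 'M[R]_3 -> 'M[R]_3}) (c t))).
Qed.

Lemma smooth_mulmx_curve h (c : R -> 'M[R]_3) :
  smooth_on setT c -> smooth_on setT (fun s => h *m c s).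
Proof.
move=> sc; apply: smooth_mulmx sc; split=> [|k]; [exact: openT|exact: Ck_cst].
Qed.

Lemma tangent_SL2R2 h : SL2R2 h -> tangent (@SL2R2 R) h = lmulset h sl2r2.
Proof.
move=> hG; apply/seteqP; split=> X.
  move=> [I [c [I0 sc cG c0 <-]]].
  have dc : differentiable c (0 : R) by exact: smooth_differentiable sc I0.
  rewrite derive1_diff //; set X' := 'd c 0 1.
  have nI : \forall t \near (0 : R), SL2R2 (c t).
    by case: sc => oI _; near=> t; apply: cG; near: t; exact: open_nbhs_nbhs.
  have [h20 h21 h22 dh] := hG; rewrite -c0 in h20 h21 h22 dh hG *.
  have coord0 j w : (forall g : 'M[R]_3, SL2R2 g -> g 2 j = w) -> X' 2 j = 0.
    move=> jw; have dm : differentiable (mxcoord 2 j) (c 0).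
      exact/linear_differentiable/mx_linear_continuous.
    have near_w : \forall s \near (0 : R), mxcoord 2 j (c s) = w.
      by apply: filterS nI => s /jw.
    have := diff_curve_cst dc dm near_w.
    have /(congr1 (fun f => f X')) e :=
      diff_lin (c 0) (@mx_linear_continuous _ _ _ _ (mxcoord 2 j)).
    by move=> z; rewrite -z; symmetry; exact: e.
  have X20 : X' 2 0 = 0 by apply: (coord0 _ 0) => g [].
  have X21 : X' 2 1 = 0 by apply: (coord0 _ 0) => g [].
  have X22 : X' 2 2 = 0 by apply: (coord0 _ 1) => g [].
  have [dd de] := is_diff_det2 (c 0).
  have near_det : \forall s \near (0 : R), det2 (c s) = 1.
    by apply: filterS nI => s [].
  have := diff_curve_cst dc dd near_det; rewrite -/X' => dX.
  have {dX}dX := etrans (esym (congr1 (fun f => f X') de)) dX.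
  have uc := SL2R2_unit hG.
  have [K XK] : exists K, X' = c 0 *m K by exists (invmx (c 0) *m X'); rewrite mulKVmx.
  exists K => //.
  have K2 j : K 2 j = X' 2 j by rewrite XK mulmx3E h20 h21 h22; ring.
  split; rewrite ?K2 //.
  move: dX; rewrite XK !mulmx3E !K2 X20 X21 => dX.
  apply/eqP; rewrite -subr_eq0 opprK; apply/eqP; rewrite -[RHS]dX.
  by transitivity ((c 0 0 0 * c 0 1 1 - c 0 0 1 * c 0 1 0) * (K 1 1 + K 0 0)); [rewrite dh mul1r|ring].
move=> [K Kg ->]; have [gamma [delta [sg sd [g0 _] [dg _] H]]] := flow_exists Kg.
have dg0 : differentiable gamma (0 : R) by exact: smooth_differentiable sg I.
exists setT, (fun t => h *m gamma t); split=> //.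
- exact: smooth_mulmx_curve.
- by move=> t _; apply: SL2R2_mul => //; case: (H t).
- by rewrite g0 mulmx1.
- have sh := smooth_mulmx_curve h sg.
  rewrite (derive1_diff (smooth_differentiable sh _)) //.
  by apply: etrans (diff_mulmx_curve h dg0) _; rewrite dg.
Unshelve. all: by end_near. Qed.

(* If X = q K(q) along M then, differentiating K = q^-1 X along the curve p gamma(t)
   and using that K stays in L, one gets dX_p(p K) = p (K K(p) + Z) with Z in L. *)
Lemma diff_section L (U : set 'M[R]_3) (X : 'M[R]_3 -> 'M[R]_3) p K :
  smooth_on U X -> U p -> SL2R2 p -> sl2r2 K ->
  (forall q, SL2R2 q -> U q -> lmulset q (vset L) (X q)) ->
  exists Kp Z, [/\ Kp \in L, Z \in L, X p = p *m Kp & 'd X p (p *m K) = p *m (K *m Kp + Z)].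
Proof.
move=> sX Up pG Kg XL; have [gamma [delta [sg sd [g0 d0] [dg dd] H]]] := flow_exists Kg.
have [Kp KpL XpE] := XL p pG Up; have up := SL2R2_unit pG.
have sc := smooth_mulmx_curve p sg.
set c := fun t => p *m gamma t in sc.
have c0 : c 0 = p by rewrite /c g0 mulmx1.
have dc : differentiable c (0 : R) by exact: smooth_differentiable sc I.
have dX : differentiable X (c 0) by rewrite c0; exact: smooth_differentiable sX Up.
have dgamma : differentiable gamma (0 : R) by exact: smooth_differentiable sg I.
have ddelta : differentiable delta (0 : R) by exact: smooth_differentiable sd I.
have dcE : 'd c 0 1 = p *m K by apply: etrans (diff_mulmx_curve p dgamma) _; rewrite dg.
have dXc := differentiable_comp dc dX.
have dXcE : 'd (X \o c) 0 1 = 'd X p (p *m K).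
  apply: etrans (congr1 (fun f => f 1) (diff_comp dc dX)) _.
  by rewrite /= dcE c0.
set b := fun t => invmx p *m X (c t).
have sinv : differentiable (mulmx (invmx p) : _ -> 'M[R]_3) (X (c 0)).
  exact/linear_differentiable/mx_linear_continuous.
have db : differentiable b (0 : R) by exact: (differentiable_comp dXc sinv).
have dbE : 'd b 0 1 = invmx p *m 'd X p (p *m K).
  by apply: etrans (diff_mulmx_curve (invmx p) dXc) _; rewrite dXcE.
have [dk dkE] := diff_mulmx ddelta db.
set k := fun t => delta t *m b t in dk dkE.
have kL : \forall t \near (0 : R), k t \in L.
  have oU : \forall t \near (0 : R), U (c t).
    have := differentiable_continuous dc; apply.
    by rewrite c0; case: sX => oU _; exact: open_nbhs_nbhs.
  apply: filterS oU => t Ut; have [dgt gt] := H t.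
  have [Kt KtL XtE] := XL _ (SL2R2_mul pG gt) Ut.
  by rewrite /k /b XtE -mulmxA mulKmx // mulmxA dgt mul1mx.
pose f : 'End('M[R]_3) := (\1 - projv L)%VF.
have fk : \forall t \near (0 : R), f (k t) = 0.
  by apply: filterS kL => t kt; rewrite /f add_lfunE opp_lfunE id_lfunE projv_id // subrr.
have df : differentiable f (k 0) by exact/linear_differentiable/mx_linear_continuous.
have fdk : f ('d k 0 1) = 0.
  have := diff_curve_cst dk df fk.
  have /(congr1 (fun F => F ('d k 0 1))) e := diff_mx_lin f (k 0).
  by move=> z; rewrite -z; symmetry; exact: e.
exists Kp, ('d k 0 1); split=> //.
  by move/eqP: fdk; rewrite add_lfunE opp_lfunE id_lfunE subr_eq0 => /eqP ->; exact: memv_proj.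
have b0 : b 0 = Kp by rewrite /b c0 XpE mulKmx.
have -> : 'd k 0 1 = (- K) *m Kp + 1%:M *m (invmx p *m 'd X p (p *m K)).
  by apply: etrans (dkE 1) _; apply: f_equal2; apply: f_equal2.
by rewrite mul1mx mulNmx addrA subrr add0r mulKVmx.
Qed.

Lemma lmulset_vset h L : lmulset h (vset L) = vset (linfun (mulmx h) @: L)%VS.
Proof.
apply/seteqP; split=> X /=.
  by move=> [K KL ->]; rewrite /vset /= -(lfunE (mulmx h)); exact: memv_img.
by rewrite /vset /= => /memv_imgP [K KL ->]; exists K => //; rewrite lfunE.
Qed.

Lemma has_rank_lmulset h L : SL2R2 h -> has_rank (lmulset h (vset L)) (\dim L).
Proof.
move=> hG; exists (linfun (mulmx h) @: L)%VS; split; first exact: lmulset_vset.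
apply: limg_dim_eq; apply/eqP; rewrite -subv0; apply/subvP => K.
rewrite memv_cap memv_ker lfunE memv0 => /andP [_ /eqP hK].
have {}hK : h *m K = 0 by exact: hK.
by rewrite -(mulKmx (SL2R2_unit hG) K) hK mulmx0.
Qed.

Lemma derived_lmulset (D : 'M[R]_3 -> set 'M[R]_3) L L' :
  (forall q, SL2R2 q -> D q = lmulset q (vset L)) ->
  (forall K, K \in L -> sl2r2 K) -> (L <= L')%VS ->
  (forall K K', K \in L -> K' \in L -> K *m K' - K' *m K \in L') ->
  (forall K, K \in L' -> exists s : seq 'M[R]_3, K \in span s /\
     forall w, w \in s -> w \in L \/ exists K1 K2, [/\ K1 \in L, K2 \in L & w = K1 *m K2 - K2 *m K1]) ->
  forall p, SL2R2 p -> derived (@SL2R2 R) D p = lmulset p (vset L').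
Proof.
move=> DL Lg LL' br span_br p pG; apply/seteqP; split=> X.
  move=> [s [sS Xs]]; rewrite lmulset_vset /vset /=.
  suff /span_subvP /subvP : {subset s <= (linfun (mulmx p) @: L')%VS} by apply.
  move=> w /sS; rewrite DL // => -[|[Y [Y' [[U [Up sY YL]] [U' [Up' sY' YL']] ->]]]].
    by move=> [K KL ->]; rewrite -(lfunE (mulmx p)); apply: memv_img; exact: (subvP LL').
  have YK q : SL2R2 q -> U q -> lmulset q (vset L) (Y q) by move=> qG Uq; rewrite -DL //; exact: YL.
  have YK' q : SL2R2 q -> U' q -> lmulset q (vset L) (Y' q) by move=> qG Uq; rewrite -DL //; exact: YL'.
  have [K KL YpE] := YK p pG Up; have [K' KL' YpE'] := YK' p pG Up'.
  have [K1 [Z [_ ZL YpE1 dY]]] := diff_section sY Up pG (Lg _ KL') YK.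
  have [K1' [Z' [_ ZL' YpE1' dY']]] := diff_section sY' Up' pG (Lg _ KL) YK'.
  have up := SL2R2_unit pG.
  have eK1 : K1 = K by rewrite -(mulKmx up K1) -YpE1 YpE mulKmx.
  have eK1' : K1' = K' by rewrite -(mulKmx up K1') -YpE1' YpE' mulKmx.
  have -> : lie_bracket Y Y' p = p *m ((K *m K' - K' *m K) + (Z' - Z)).
    transitivity (p *m (K *m K' + Z') - p *m (K' *m K + Z)).
      rewrite eK1 in dY; rewrite eK1' in dY'.
      rewrite /lie_bracket YpE YpE'; apply: f_equal2; first exact: dY'.
      by apply: f_equal; exact: dY.
    by rewrite -mulmxBr; congr (_ *m _); rewrite opprD addrACA.
  rewrite -(lfunE (mulmx p)); apply: memv_img; apply: memvD; first exact: br.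
  by apply: (subvP LL'); exact: memvB.
move=> [K /span_br [s [Ks sP]] ->].
exists [seq p *m w | w <- s]; split; last first.
  have -> : [seq p *m w | w <- s] = map (linfun (mulmx p) : _ -> 'M[R]_3) s.
    by apply: eq_map => w; rewrite lfunE.
  by rewrite -limg_span -(lfunE (mulmx p)); exact: memv_img.
move=> w /mapP [v /sP vP ->]; case: vP => [vL|[K1 [K2 [K1L K2L ->]]]].
  by left; rewrite DL //; exists v.
right; exists (fun q => q *m K1), (fun q => q *m K2).
have sec K0 : K0 \in L -> local_section (@SL2R2 R) D p (fun q => q *m K0).
  move=> K0L; exists setT; split=> //; last by move=> q qG _; rewrite DL //; exists K0.
  have := smooth_affine (mulmxr K0 : {linear 'M[R]_3 -> 'M[R]_3}) 0.
  by congr smooth_on; apply/funext => q; rewrite addr0.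
split; [exact: sec|exact: sec|].
have dK K0 u : 'd (fun q : 'M[R]_3 => q *m K0) p u = u *m K0.
  exact: (congr1 (fun f => f u) (diff_mx_lin (mulmxr K0 : {linear 'M[R]_3 -> 'M[R]_3}) p)).
transitivity (p *m K1 *m K2 - p *m K2 *m K1); first by rewrite mulmxBr !mulmxA.
by symmetry; rewrite /lie_bracket; apply: f_equal2; [exact: dK|apply: f_equal; exact: dK].
Qed.

End LeftInvariant.

Section RowValued.
Context {R : realType} {V : normedModType R} {n : nat}.

Lemma row_sum (r : 'I_n -> R) : \row_j r j = \sum_j r j *: delta_mx 0 j :> 'rV[R]_n.
Proof. by rewrite [LHS]row_sum_delta; apply: eq_bigr => j _; rewrite mxE. Qed.

Lemma Ck_row k (O : set V) (f : 'I_n -> V -> R) : open O ->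
  (forall j, Ck k O (f j)) -> Ck k O (fun x => \row_j f j x).
Proof.
move=> oO fk; have -> : (fun x => \row_j f j x) = fun x => \sum_j f j x *: delta_mx 0 j.
  by apply/funext => x; rewrite row_sum.
elim: (index_enum _) => [|j s IH].
  have -> : (fun x : V => \sum_(j <- [::]) f j x *: delta_mx 0 j) = fun _ => 0 :> 'rV[R]_n.
    by apply/funext => x; rewrite big_nil.
  exact: Ck_cst.
have -> : (fun x => \sum_(j <- j :: s) f j x *: delta_mx 0 j) =
    (fun x => f j x *: delta_mx 0 j) + (fun x => \sum_(j <- s) f j x *: delta_mx 0 j) :> (V -> 'rV[R]_n).
  by apply/funext => x; rewrite big_cons.
apply: CkD => //; pose w : 'rV[R]_n := delta_mx 0 j.
have lin : linear ( *:%R ^~ w : R -> _) by move=> u y z; rewrite scalerDl scalerA.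
pose lM := GRing.isLinear.Build _ _ _ _ _ lin.
pose l : {linear _ -> _} := HB.pack ( *:%R ^~ w : R -> _) lM.
by apply: (Ck_comp_lin (f := l) (g := f j)) => //; exact: scalel_continuous.
Qed.

Lemma diff_row (f : 'I_n -> V -> R) x : (forall j, differentiable (f j) x) ->
  forall v, 'd (fun y => \row_j f j y) x v = \row_j 'd (f j) x v.
Proof.
move=> fd v.
have Fd : differentiable (fun y => \row_j f j y) x.
  have -> : (fun y => \row_j f j y) = \sum_j (fun y => f j y *: (delta_mx 0 j : 'rV[R]_n)).
    by apply/funext => y; rewrite row_sum fct_sumE.
  by apply: differentiable_sum => j; exact: differentiableZl.
apply/rowP => j; rewrite mxE.
have cd : differentiable (mxcoord 0 j) (\row_j f j x).
  exact/linear_differentiable/mx_linear_continuous.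
have /(congr1 (fun g => g v)) e1 := diff_comp Fd cd.
have /(congr1 (fun g => g ('d (fun y => \row_j f j y) x v))) e2 :=
  diff_lin (\row_j f j x) (@mx_linear_continuous _ _ _ _ (mxcoord 0 j)).
have e3 : mxcoord 0 j \o (fun y => \row_j f j y) = f j.
  by apply/funext => y; rewrite /= /mxcoord mxE.
rewrite e3 in e1.
by rewrite e1; symmetry; exact: e2.
Qed.

End RowValued.

Section Planes.
Context {R : realType}.
Implicit Types (h K : 'M[R]_3) (a b c d e : R).

Lemma mem_spanP (V : vectType R) (X : seq V) (w : V) :
  w \in span X <-> exists k : nat -> R, w = \sum_(i < size X) k i *: X`_i.
Proof.
split=> [wX|[k ->]].
  exists (fun i => if insub i is Some j then coord (in_tuple X) j w else 0).
  by rewrite {1}(coord_span (X := in_tuple X) wX); apply: eq_bigr => i _; rewrite valK.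
by apply: memv_suml => i _; apply/memvZ/memv_span/mem_nth.
Qed.

Lemma sum_nth_ord (V : lmodType R) (X : seq V) (k : nat -> R) :
  \sum_(i < size X) k i *: X`_i = \sum_(i <- iota 0 (size X)) k i *: X`_i.
Proof. by rewrite -(big_mkord xpredT (fun i => k i *: X`_i)) /index_iota subn0. Qed.

Lemma aff_bracket a b c d e a' b' c' d' e' :
  aff a b c d e *m aff a' b' c' d' e' - aff a' b' c' d' e' *m aff a b c d e =
  aff (2 * (c * a' - a * c')) (2 * (b * c' - c * b')) (a * b' - b * a')
    (c * d' + a * e' - c' * d - a' * e) (b * d' - c * e' - b' * d + c' * e).
Proof.
have [[m00 m01 m02] [[m10 m11 m12] [m20 m21 m22]]] := affE a b c d e.
have [[n00 n01 n02] [[n10 n11 n12] [n20 n21 n22]]] := affE a' b' c' d' e'.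
set M := aff a b c d e in m00 m01 m02 m10 m11 m12 m20 m21 m22 *.
set N := aff a' b' c' d' e' in n00 n01 n02 n10 n11 n12 n20 n21 n22 *.
set P := aff _ _ _ _ _.
have [[p00 p01 p02] [[p10 p11 p12] [p20 p21 p22]]] := affE
  (2 * (c * a' - a * c')) (2 * (b * c' - c * b')) (a * b' - b * a')
    (c * d' + a * e' - c' * d - a' * e) (b * d' - c * e' - b' * d + c' * e).
have E i j : (M *m N - N *m M) i j = M i 0 * N 0 j + M i 1 * N 1 j + M i 2 * N 2 j
    - (N i 0 * M 0 j + N i 1 * M 1 j + N i 2 * M 2 j).
  by rewrite -!mulmx3E !mxE.
apply/matrixP; do 2!elim/ord3P; rewrite E
  ?(m00, m01, m02, m10, m11, m12, m20, m21, m22, n00, n01, n02, n10, n11, n12, n20, n21, n22);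
  rewrite ?(p00, p01, p02, p10, p11, p12, p20, p21, p22); ring.
Qed.

Definition mc_basis2 : seq 'M[R]_3 := [:: aff 1 1 0 0 0; aff 1 0 1 (-1) 1].
Definition mc_basis3 : seq 'M[R]_3 := [:: aff 1 0 0 0 0; aff 0 1 0 0 0; aff 0 0 1 (-1) 1].
Definition mc_basis5 : seq 'M[R]_3 :=
  [:: aff 1 0 0 0 0; aff 0 1 0 0 0; aff 0 0 1 0 0; aff 0 0 0 1 0; aff 0 0 0 0 1].

Lemma mem_mc_basis2 K : K \in span mc_basis2 <-> exists b c, K = aff (b + c) b c (- c) c.
Proof.
split=> [/mem_spanP [k ->]|[b [c ->]]].
  exists (k 0%N), (k 1%N); rewrite sum_nth_ord /= !big_cons big_nil /= !affZ addr0 !affD.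
  by apply: eq_aff; ring.
apply/mem_spanP; exists (nth 0 [:: b; c]).
by rewrite sum_nth_ord /= !big_cons big_nil /= !affZ addr0 !affD; apply: eq_aff; ring.
Qed.

Lemma mem_mc_basis3 K : K \in span mc_basis3 <-> exists a b c, K = aff a b c (- c) c.
Proof.
split=> [/mem_spanP [k ->]|[a [b [c ->]]]].
  exists (k 0%N), (k 1%N), (k 2%N); rewrite sum_nth_ord /= !big_cons big_nil /= !affZ addr0 !affD.
  by apply: eq_aff; ring.
apply/mem_spanP; exists (nth 0 [:: a; b; c]).
by rewrite sum_nth_ord /= !big_cons big_nil /= !affZ addr0 !affD; apply: eq_aff; ring.
Qed.

Lemma mem_mc_basis5 K : K \in span mc_basis5 <-> exists a b c d e, K = aff a b c d e.
Proof.
split=> [/mem_spanP [k ->]|[a [b [c [d [e ->]]]]]].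
  exists (k 0%N), (k 1%N), (k 2%N), (k 3%N), (k 4%N).
  rewrite sum_nth_ord /= !big_cons big_nil /= !affZ addr0 !affD; apply: eq_aff; ring.
apply/mem_spanP; exists (nth 0 [:: a; b; c; d; e]).
by rewrite sum_nth_ord /= !big_cons big_nil /= !affZ addr0 !affD; apply: eq_aff; ring.
Qed.

Lemma free_natP (V : vectType R) (X : seq V) :
  (forall k : nat -> R, \sum_(i < size X) k i *: X`_i = 0 -> forall i, (i < size X)%N -> k i = 0) ->
  free X.
Proof.
move=> H; apply/(@freeP _ _ _ (in_tuple X)) => k Hk i.
pose k' j := if insub j is Some j' then k j' else 0.
have k'E (j : 'I_(size X)) : k' j = k j by rewrite /k' valK.
rewrite -k'E; apply: (H k') => //; rewrite -[RHS]Hk.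
by apply: eq_bigr => j _; rewrite k'E.
Qed.

Lemma free_mc_basis2 : free mc_basis2.
Proof.
apply: free_natP => k; rewrite sum_nth_ord /= !big_cons big_nil /= !affZ addr0 !affD -aff0.
move=> /aff_inj [h1 h2 h3 h4 h5]; have k1 : k 1%N = 0 by rewrite -h3; ring.
have k0 : k 0%N = 0 by rewrite -h2; ring.
by case=> [|[|//]] _.
Qed.

Lemma free_mc_basis3 : free mc_basis3.
Proof.
apply: free_natP => k; rewrite sum_nth_ord /= !big_cons big_nil /= !affZ addr0 !affD -aff0.
move=> /aff_inj [h1 h2 h3 h4 h5].
have k0 : k 0%N = 0 by rewrite -h1; ring.
have k1 : k 1%N = 0 by rewrite -h2; ring.
have k2 : k 2%N = 0 by rewrite -h3; ring.
by case=> [|[|[|//]]] _.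
Qed.

Lemma free_mc_basis5 : free mc_basis5.
Proof.
apply: free_natP => k; rewrite sum_nth_ord /= !big_cons big_nil /= !affZ addr0 !affD -aff0.
move=> /aff_inj [h1 h2 h3 h4 h5].
have k0 : k 0%N = 0 by rewrite -h1; ring.
have k1 : k 1%N = 0 by rewrite -h2; ring.
have k2 : k 2%N = 0 by rewrite -h3; ring.
have k3 : k 3%N = 0 by rewrite -h4; ring.
have k4 : k 4%N = 0 by rewrite -h5; ring.
by case=> [|[|[|[|[|//]]]]] _.
Qed.

Lemma E_basis_sum (k : nat -> R) : \sum_(i < 6) k i *: (E_basis : seq 'M[R]_3)`_i =
  aff (k 0%N) (k 1%N) (k 2%N) (k 3%N) (k 4%N) + k 5%N *: (delta_mx 0 0 + delta_mx 1 1).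
Proof.
by rewrite [LHS](sum_nth_ord (E_basis : seq _) k) /= !big_cons big_nil /= addr0 /aff -lock !addrA.
Qed.

Lemma free_E_basis : free (@E_basis R).
Proof.
apply: free_natP => k; rewrite (E_basis_sum k) => /matrixP H.
have [[m00 m01 m02] [[m10 m11 m12] [m20 m21 m22]]] :=
  affE (k 0%N) (k 1%N) (k 2%N) (k 3%N) (k 4%N).
have E i j : aff (k 0%N) (k 1%N) (k 2%N) (k 3%N) (k 4%N) i j
    + k 5%N * (((i == 0) && (j == 0))%:R + ((i == 1) && (j == 1))%:R) = 0.
  have := H i j; rewrite [in RHS]mxE => <-.
  by rewrite mxE; congr (_ + _); rewrite !mxE.
have k0 : k 0%N = 0 by have := E 0 1; rewrite m01 /= ?(addr0, mulr0).
have k1 : k 1%N = 0 by have := E 1 0; rewrite m10 /= ?(addr0, mulr0).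
have k3 : k 3%N = 0 by have := E 0 2; rewrite m02 /= ?(addr0, mulr0).
have k4 : k 4%N = 0 by have := E 1 2; rewrite m12 /= ?(addr0, mulr0).
have := E 0 0; have := E 1 1; rewrite m00 m11 /= => e1 e2.
have k2 : k 2%N = 0 by lra.
have k5 : k 5%N = 0 by lra.
by case=> [|[|[|[|[|[|//]]]]]] _.
Qed.

Lemma tau_aff (k : nat) h a b c d e : SL2R2 h -> (k < 6)%N ->
  tau k.+1 h (h *m aff a b c d e) = nth 0 [:: a; b; c; d; e; 0] k.
Proof.
move=> hG k6; rewrite /tau mulKmx ?SL2R2_unit //=.
have := E_basis_sum (nth 0 [:: a; b; c; d; e; 0]); rewrite /= scale0r addr0 => <-.
by rewrite (coord_sum_free _ _ free_E_basis) inordK.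
Qed.

Lemma MC_distributionE h : SL2R2 h -> MC_distribution h = lmulset h (vset (span mc_basis2)).
Proof.
move=> hG; apply/seteqP; split=> X.
  move=> [+ + + +]; rewrite tangent_SL2R2 // => -[K /sl2r2P ->].
  move: (K 0 1) (K 1 0) (K 0 0) (K 0 2) (K 1 2) => a b c d e ->.
  rewrite /theta1 /theta2 /theta3 !tau_aff //= => h1 h2 h3.
  exists (aff a b c d e) => //; apply/mem_mc_basis2; exists b, c.
  by apply: eq_aff; lra.
move=> [_ /mem_mc_basis2 [b [c ->]] ->]; split.
- by rewrite tangent_SL2R2 //; exists (aff (b + c) b c (- c) c) => //; exact: sl2r2_aff.
- by rewrite /theta1 !tau_aff //=; ring.
- by rewrite /theta2 !tau_aff //=; ring.
- by rewrite /theta3 !tau_aff //=; ring.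
Qed.

Lemma derived_MC1 h : SL2R2 h ->
  derived (@SL2R2 R) MC_distribution h = lmulset h (vset (span mc_basis3)).
Proof.
apply: (derived_lmulset (L := span mc_basis2)).
- exact: MC_distributionE.
- by move=> K /mem_mc_basis2 [b [c ->]]; exact: sl2r2_aff.
- by apply/subvP => K /mem_mc_basis2 [b [c ->]]; apply/mem_mc_basis3; exists (b + c), b, c.
- move=> K K' /mem_mc_basis2 [b [c ->]] /mem_mc_basis2 [b' [c' ->]].
  rewrite aff_bracket; apply/mem_mc_basis3.
  exists (2 * (c * (b' + c') - (b + c) * c')), (2 * (b * c' - c * b')), ((b + c) * b' - b * (b' + c')).
  by apply: eq_aff => //; ring.
- move=> K /mem_mc_basis3 [a [b [c ->]]].
  pose k1 : 'M[R]_3 := aff 1 1 0 0 0; pose k2 : 'M[R]_3 := aff 1 0 1 (-1) 1.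
  exists [:: k1; k2; k1 *m k2 - k2 *m k1]; split.
    pose z := (b + c - a) / 3.
    apply/mem_spanP; exists (nth 0 [:: b - 2 * z; c + z; z]).
    rewrite aff_bracket sum_nth_ord /= !big_cons big_nil /= !affZ addr0 !affD.
    by apply: eq_aff; rewrite /z; field.
  have k1L : k1 \in span mc_basis2 by apply/memv_span; rewrite mem_head.
  have k2L : k2 \in span mc_basis2 by apply/memv_span; rewrite !inE eqxx orbT.
  move=> w; rewrite !inE => /or3P [] /eqP ->; [by left|by left|right].
  by exists k1, k2.
Qed.

Lemma derived_MC2 h : SL2R2 h ->
  derived (@SL2R2 R) (derived (@SL2R2 R) MC_distribution) h = lmulset h (vset (span mc_basis5)).
Proof.
apply: (derived_lmulset (L := span mc_basis3)).
- exact: derived_MC1.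
- by move=> K /mem_mc_basis3 [a [b [c ->]]]; exact: sl2r2_aff.
- by apply/subvP => K /mem_mc_basis3 [a [b [c ->]]]; apply/mem_mc_basis5; exists a, b, c, (- c), c.
- move=> K K' /mem_mc_basis3 [a [b [c ->]]] /mem_mc_basis3 [a' [b' [c' ->]]].
  by rewrite aff_bracket; apply/mem_mc_basis5; do 5!eexists.
- move=> K /mem_mc_basis5 [a [b [c [d [e ->]]]]].
  pose e1 : 'M[R]_3 := aff 1 0 0 0 0; pose e2 : 'M[R]_3 := aff 0 1 0 0 0.
  pose w : 'M[R]_3 := aff 0 0 1 (-1) 1.
  exists [:: e1; e2; e1 *m e2 - e2 *m e1; e1 *m w - w *m e1; e2 *m w - w *m e2]; split.
    apply/mem_spanP; exists (nth 0 [:: a + 2 * d; b + 2 * e; c; d; - e]).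
    rewrite !aff_bracket sum_nth_ord /= !big_cons big_nil /= !affZ addr0 !affD.
    by apply: eq_aff; ring.
  have e1L : e1 \in span mc_basis3 by apply/memv_span; rewrite mem_head.
  have e2L : e2 \in span mc_basis3 by apply/memv_span; rewrite !inE eqxx orbT.
  have wL : w \in span mc_basis3 by apply/memv_span; rewrite !inE eqxx !orbT.
  move=> v; rewrite !inE => /or4P [/eqP ->|/eqP ->|/eqP ->|/orP [] /eqP ->]; [by left|by left|right..].
  - by exists e1, e2.
  - by exists e1, w.
  - by exists e2, w.
Qed.

End Planes.

Section ScalarFunctions.
Context {R : realType}.
Implicit Types V : normedModType R.

Lemma CkZ V k (O : set V) (a : R) (f : V -> R) : open O -> Ck k O f -> Ck k O (a *: f).
Proof.
move=> oO fk; apply: (Ck_comp_lin (f := *:%R a : {linear R -> R})) => //.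
exact: scaler_continuous.
Qed.

Lemma CkB V k (O : set V) (f g : V -> R) : open O -> Ck k O f -> Ck k O g -> Ck k O (f - g).
Proof.
by move=> oO fk gk; rewrite -scaleN1r; apply: CkD => //; exact: CkZ.
Qed.

Lemma Ck_mxcoord m n i j k (O : set 'M[R]_(m, n)) : Ck k O (fun M => M i j).
Proof. by apply: (@Ck_lin R _ _ k O (mxcoord i j)); exact: mx_linear_continuous. Qed.

Lemma is_diff_mxcoord m n i j (M : 'M[R]_(m, n)) : is_diff M (fun N => N i j) (fun N => N i j).
Proof.
have d : differentiable (mxcoord i j) M.
  exact/linear_differentiable/mx_linear_continuous.
have e := diff_lin M (@mx_linear_continuous _ _ _ _ (mxcoord i j)).
by apply: DiffDef; [exact: d|exact: e].
Qed.

Lemma is_diffBc V (f df : V -> R) (c : R) x : is_diff x f df -> is_diff x (fun y => f y - c) df.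
Proof.
move=> fd; have [d e] := is_diffB fd (is_diff_cst c x).
by apply: DiffDef => //; apply: etrans e _; rewrite subr0.
Qed.

Lemma Ck_det2 k (O : set 'M[R]_3) : open O -> Ck k O (@det2 R).
Proof. by move=> oO; apply: CkB => //; exact: Ck_mxcoordM. Qed.

Lemma open_neq0 V (f : V -> R) : continuous f -> open [set x | f x != 0].
Proof.
move=> fc; apply: (@open_comp _ _ f [set y | y != 0]) => [x _|]; first exact: fc.
exact: open_neq.
Qed.

End ScalarFunctions.

Lemma free_of_rank (R : realType) m n (X : seq 'M[R]_(m, n)) :
  has_rank (vset (span X)) (size X) -> free X.
Proof.
move=> [L [/seteqP [s1 s2] dL]]; apply/eqP; rewrite -dL; congr (\dim _).
by apply/vspaceP => v; apply/idP/idP; [exact: s1|exact: s2].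
Qed.

Section MaurerCartan.
Context {R : realType}.

Let defining (j : 'I_4) (h : 'M[R]_3) : R :=
  nth 0 [:: h 2 0; h 2 1; h 2 2 - 1; det2 h - 1] j.

Let Ddefining (h v : 'M[R]_3) : seq R := [:: v 2 0; v 2 1; v 2 2;
  (v 0 0 * h 1 1 + h 0 0 * v 1 1) - (v 0 1 * h 1 0 + h 0 1 * v 1 0)].

Lemma submanifold_SL2R2 : submanifold 5 (@SL2R2 R).
Proof.
move=> p pG; exists 4%N, [set h | det2 h != 0], (fun h => \row_j defining j h).
have oU : open [set h : 'M[R]_3 | det2 h != 0].
  apply: open_neq0 => h; apply: differentiable_continuous.
  by case: (is_diff_det2 h).
have dF h j : is_diff h (defining j) (fun v => nth 0 (Ddefining h v) j).
  case: j => -[|[|[|[|//]]]] ltj; rewrite /defining /=.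
  - exact: is_diff_mxcoord.
  - exact: is_diff_mxcoord.
  - exact/is_diffBc/is_diff_mxcoord.
  - exact/is_diffBc/is_diff_det2.
split=> //.
- by case: pG => _ _ _ /= dp; rewrite /det2 dp oner_neq0.
- split=> // k; apply: Ck_row => // -[[|[|[|[|//]]]] ltj]; rewrite /defining /=.
  + exact: Ck_mxcoord.
  + exact: Ck_mxcoord.
  + by apply: CkB => //; [exact: Ck_mxcoord|exact: Ck_cst].
  + by apply: CkB => //; [exact: Ck_det2|exact: Ck_cst].
- move=> q /= q0 w; pose s := w 0 3 / det2 q.
  pose v : 'M[R]_3 := w 0 0 *: delta_mx 2 0 + w 0 1 *: delta_mx 2 1 + w 0 2 *: delta_mx 2 2
    + (s * q 0 0) *: delta_mx 0 0 + (s * q 0 1) *: delta_mx 0 1.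
  exists v; apply: etrans (diff_row (fun j => @ex_diff _ _ _ _ _ _ _ (dF q j)) v) _.
  apply/rowP => j; rewrite mxE.
  have -> : 'd (defining j) q v = nth 0 (Ddefining q v) j.
    by case: (dF q j) => _ e; exact: (congr1 (fun f => f v) e).
  case: j => -[|[|[|[|//]]]] ltj; rewrite /Ddefining /v /= !mxE /=.
  + by rewrite (_ : Ordinal ltj = 0); [ring|exact/val_inj].
  + by rewrite (_ : Ordinal ltj = 1); [ring|exact/val_inj].
  + by rewrite (_ : Ordinal ltj = 2); [ring|exact/val_inj].
  + rewrite (_ : Ordinal ltj = 3); last exact/val_inj.
    rewrite /s; move: q0; rewrite /det2 => q0; field.
    by [].
- move=> q _; split=> [[q20 q21 q22 dq]|/rowP H].
    apply/rowP => -[[|[|[|[|//]]]] ltj]; rewrite !mxE /defining /= ?q20 ?q21 ?q22 ?subrr //.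
    by rewrite /det2 dq subrr.
  have := H 0; have := H 1; have := H 2; have := H 3; rewrite !mxE /defining /=.
  by move=> /eqP; rewrite subr_eq0 => /eqP ? /eqP; rewrite subr_eq0 => /eqP.
Qed.

Lemma dim_mc_basis2 : \dim (span (@mc_basis2 R)) = 2.
Proof. exact/eqP/free_mc_basis2. Qed.

Lemma dim_mc_basis3 : \dim (span (@mc_basis3 R)) = 3.
Proof. exact/eqP/free_mc_basis3. Qed.

Lemma dim_mc_basis5 : \dim (span (@mc_basis5 R)) = 5.
Proof. exact/eqP/free_mc_basis5. Qed.

Lemma is_distribution_MC : is_distribution (@SL2R2 R) 2 MC_distribution.
Proof.
split=> [p _ X []//|p pG].
exists setT, (fun i q => q *m mc_basis2`_i); split=> // [i|q qG _].
  have := smooth_affine (mulmxr mc_basis2`_i : {linear 'M[R]_3 -> 'M[R]_3}) 0.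
  by congr smooth_on; apply/funext => q; rewrite addr0.
have -> : [seq q *m mc_basis2`_i | i : 'I_2] = map (linfun (mulmx q) : _ -> 'M[R]_3) mc_basis2.
  rewrite /image_mem enum_ordSl enum_ordSl enum_ord0 /=.
  by rewrite !lfunE.
have DE : MC_distribution q = vset (span (map (linfun (mulmx q) : _ -> 'M[R]_3) mc_basis2)).
  by rewrite -limg_span -lmulset_vset MC_distributionE.
split=> //; apply: free_of_rank; rewrite -DE MC_distributionE //.
by have := has_rank_lmulset (span mc_basis2) qG; rewrite dim_mc_basis2 size_map.
Qed.

Lemma is_235_MC : is_235 (@SL2R2 R) MC_distribution.
Proof.
split; [exact: submanifold_SL2R2|exact: is_distribution_MC|move=> p pG].
rewrite /derived_flag /=; split.
- by rewrite MC_distributionE //; have := has_rank_lmulset (span mc_basis2) pG; rewrite dim_mc_basis2.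
- by rewrite derived_MC1 //; have := has_rank_lmulset (span mc_basis3) pG; rewrite dim_mc_basis3.
- by rewrite derived_MC2 //; have := has_rank_lmulset (span mc_basis5) pG; rewrite dim_mc_basis5.
Qed.

Lemma lmulset_mul (h k : 'M[R]_3) S :
  [set h *m X | X in lmulset k S] = lmulset (h *m k) S.
Proof.
apply/seteqP; split=> X; first by move=> [_ [K SK ->] <-]; exists K; rewrite ?mulmxA.
by move=> [K SK ->]; exists (k *m K); [exists K|rewrite mulmxA].
Qed.

Lemma homogeneous_MC : homogeneous (@SL2R2 R) MC_distribution.
Proof.
move=> p q pG qG; have [up uq] := (SL2R2_unit pG, SL2R2_unit qG).
pose a := q *m invmx p; pose b := p *m invmx q.
have aG : SL2R2 a by apply: SL2R2_mul => //; exact: SL2R2_inv.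
have bG : SL2R2 b by apply: SL2R2_mul => //; exact: SL2R2_inv.
have ab x : a *m (b *m x) = x.
  by rewrite mulmxA /a /b -(mulmxA q) mulKmx // mulmxV // mul1mx.
have ba x : b *m (a *m x) = x.
  by rewrite mulmxA /a /b -(mulmxA p) mulKmx // mulmxV // mul1mx.
have sm (h : 'M[R]_3) : smooth_on setT (mulmx h : 'M[R]_3 -> 'M[R]_3).
  have := smooth_affine (mulmx h : {linear 'M[R]_3 -> 'M[R]_3}) 0.
  by congr smooth_on; apply/funext => x; rewrite addr0.
exists setT, setT, (mulmx a), (mulmx b); split; split=> //.
- by rewrite /a mulmxKV.
- by move=> x xG _; split=> //; exact: SL2R2_mul.
- by move=> x xG _; split=> //; exact: SL2R2_mul.
- move=> x xG _; rewrite (MC_distributionE (SL2R2_mul aG xG)) (MC_distributionE xG).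
  rewrite -lmulset_mul; apply: eq_imagel => X _.
  exact: (congr1 (fun f => f X) (diff_mx_lin (mulmx a : {linear 'M[R]_3 -> 'M[R]_3}) x)).
Qed.

End MaurerCartan.

Section AffineTransfer.
Context {R : realType} {m n m' n' : nat}.
Local Notation V := 'M[R]_(m, n).
Local Notation W := 'M[R]_(m', n').
Variables (M1 : set V) (M2 : set W) (f : {linear V -> W}) (g : {linear W -> V}) (c : W) (d : V).
Let phi (x : V) : W := f x + c.
Let psi (y : W) : V := g y + d.
Hypothesis phiM : forall x, M1 x -> M2 (phi x).
Hypothesis psiM : forall y, M2 y -> M1 (psi y).
Hypothesis phiK : forall x, M1 x -> psi (phi x) = x.
Hypothesis psiK : forall y, M2 y -> phi (psi y) = y.
Hypothesis fK : cancel f g.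

Definition pushes (D1 : V -> set V) (D2 : W -> set W) :=
  forall x, M1 x -> f @` D1 x = D2 (phi x).

Lemma tangent_affine x v : tangent M2 (phi x) (f v) -> M1 x -> tangent M1 x v.
Proof.
move=> [I [gam [I0 sgam gamM gam0 dgam]]] Mx.
have dg : differentiable gam (0 : R) by exact: smooth_differentiable sgam I0.
have spsi := smooth_comp_affine g d sgam.
exists I, (fun t => psi (gam t)); split=> //.
- by move=> t It; apply/psiM/gamM.
- by rewrite gam0 phiK.
- have dpsi := smooth_differentiable spsi I0.
  rewrite (derive1_diff dpsi).
  have [dp pE] := is_diff_affine g d (gam 0).
  apply: etrans (congr1 (fun F => F 1) (diff_comp dg dp)) _ => /=.
  apply: etrans (congr1 (fun F => F _) pE) _.
  by rewrite -(derive1_diff dg) dgam fK.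
Qed.

Lemma has_rank_affine D1 D2 x k : pushes D1 D2 -> M1 x ->
  (forall w, D2 (phi x) w -> f (g w) = w) -> has_rank (D2 (phi x)) k -> has_rank (D1 x) k.
Proof.
move=> D12 Mx fgK [L [LE <-]]; exists (linfun g @: L)%VS; split.
  apply/seteqP; split=> [v vD|v].
    have : D2 (phi x) (f v) by rewrite -D12 //; exists v.
    by rewrite LE /vset /= => fvL; rewrite -(fK v) -(lfunE g); exact: memv_img.
  rewrite /vset /= => /memv_imgP [w wL ->]; rewrite lfunE.
  have : D2 (phi x) w by rewrite LE.
  by rewrite -D12 // => -[u uD <-]; rewrite fK.
apply: limg_dim_eq; apply/eqP; rewrite -subv0; apply/subvP => w.
rewrite memv_cap memv_ker lfunE memv0 => /andP [wL /eqP gw].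
have {}gw : g w = 0 by exact: gw.
by rewrite -(fgK w) ?LE // gw linear0.
Qed.

Lemma lspan_linear m1 n1 m2 n2 (h : {linear 'M[R]_(m1, n1) -> 'M[R]_(m2, n2)})
    (S : set 'M[R]_(m1, n1)) (S' : set 'M[R]_(m2, n2)) v :
  (forall w, S w -> S' (h w)) -> lspan S v -> lspan S' (h v).
Proof.
move=> SS' [s [sS vs]]; exists (map h s); split.
  by move=> _ /mapP [w ws ->]; apply/SS'/sS.
have -> : map h s = map (linfun h : _ -> 'M[R]_(m2, n2)) s.
  by apply: eq_map => w; rewrite lfunE.
by rewrite -limg_span -(lfunE h); exact: memv_img.
Qed.

Lemma pushes_derived D1 D2 : pushes D1 D2 ->
  (forall y w, M2 y -> derived M2 D2 y w -> f (g w) = w) ->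
  pushes (derived M1 D1) (derived M2 D2).
Proof.
move=> D12 fgK x Mx; have My := phiM Mx.
have conj_diff (m1 n1 m2 n2 : nat) (l : {linear 'M[R]_(m1, n1) -> 'M[R]_(m2, n2)})
    (l' : {linear 'M[R]_(m2, n2) -> 'M[R]_(m1, n1)}) (e : 'M[R]_(m1, n1))
    (U : set 'M[R]_(m1, n1)) (X : 'M[R]_(m1, n1) -> 'M[R]_(m1, n1)) y u :
    smooth_on U X -> U (l' y + e) ->
    'd (fun q => l (X (l' q + e))) y u = l ('d X (l' y + e) (l' u)).
  move=> sX Uy; have [da aE] := is_diff_affine l' e y.
  have dX := smooth_differentiable sX Uy.
  have dXa := differentiable_comp da dX.
  have dl : differentiable l (X (l' y + e)) by exact/linear_differentiable/mx_linear_continuous.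
  apply: etrans (congr1 (fun F => F u) (diff_comp dXa dl)) _ => /=.
  apply: etrans (congr1 (fun F => F _) (diff_mx_lin l _)) _; congr (l _).
  apply: etrans (congr1 (fun F => F u) (diff_comp da dX)) _ => /=.
  by congr ('d X _ _); exact: (congr1 (fun F => F u) aE).
have conj_smooth (m1 n1 m2 n2 : nat) (l : {linear 'M[R]_(m1, n1) -> 'M[R]_(m2, n2)})
    (l' : {linear 'M[R]_(m2, n2) -> 'M[R]_(m1, n1)}) (e : 'M[R]_(m1, n1))
    (U : set 'M[R]_(m1, n1)) (X : 'M[R]_(m1, n1) -> 'M[R]_(m1, n1)) :
    smooth_on U X -> smooth_on ((fun q => l' q + e) @^-1` U) (fun q => l (X (l' q + e))).
  move=> [oU CX]; have ac : continuous (fun q => l' q + e).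
    by move=> z; apply: differentiable_continuous; case: (is_diff_affine l' e z).
  split=> [|k]; first by apply: open_comp => // z _; exact: ac.
  have CXa := Ck_precomp oU ac (is_diff_affine l' e) (CX k).
  apply: (Ck_comp_lin (f := l)) => //; last exact: mx_linear_continuous.
  by apply: open_comp => // z _; exact: ac.
have sec2 X : local_section M1 D1 x X -> local_section M2 D2 (phi x) (fun q => f (X (psi q))).
  move=> [U [Ux sX XD]]; exists (psi @^-1` U); split.
  - by rewrite /preimage /= phiK.
  - exact: (conj_smooth _ _ _ _ f g d).
  - move=> q Mq Uq; have Mp := psiM Mq.
    have : D2 (phi (psi q)) (f (X (psi q))) by rewrite -D12 //; exists (X (psi q)) => //; exact: XD.
    by rewrite psiK.
have sec1 X : local_section M2 D2 (phi x) X -> local_section M1 D1 x (fun q => g (X (phi q))).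
  move=> [U [Ux sX XD]]; exists (phi @^-1` U); split=> //.
  - exact: (conj_smooth _ _ _ _ g f c).
  - move=> q Mq Uq; have := XD _ (phiM Mq) Uq.
    by rewrite -D12 // => -[v vD <-]; rewrite fK.
apply/seteqP; split=> [_ [v vD <-]|w wD].
  apply: lspan_linear vD => w [wD|[X [Y [sX sY ->]]]].
    by left; rewrite -D12 //; exists w.
  right; exists (fun q => f (X (psi q))), (fun q => f (Y (psi q))); split; [exact: sec2|exact: sec2|].
  have [[U [Ux smX _]] [U' [Ux' smY _]]] := (sX, sY).
  have ex : psi (phi x) = x := phiK Mx.
  rewrite /lie_bracket linearB; symmetry; apply: f_equal2; [|apply: f_equal].
    by apply: etrans (conj_diff _ _ _ _ f g d U' Y _ _ smY _) _; rewrite -/(psi _) ex ?fK.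
  by apply: etrans (conj_diff _ _ _ _ f g d U X _ _ smX _) _; rewrite -/(psi _) ex ?fK.
exists (g w); last exact: fgK wD.
apply: lspan_linear wD => u [uD|[X [Y [sX sY ->]]]].
  by left; move: uD; rewrite -D12 // => -[v vD <-]; rewrite fK.
right; exists (fun q => g (X (phi q))), (fun q => g (Y (phi q))); split; [exact: sec1|exact: sec1|].
have [[U [Ux smX XD]] [U' [Ux' smY YD]]] := (sX, sY).
have fgE u' : D2 (phi x) u' -> f (g u') = u' by rewrite -D12 // => -[v _ <-]; rewrite fK.
rewrite /lie_bracket linearB; symmetry; apply: f_equal2; [|apply: f_equal].
  apply: etrans (conj_diff _ _ _ _ g f c U' Y _ _ smY _) _ => //.
  by rewrite fgE //; exact: XD.
apply: etrans (conj_diff _ _ _ _ g f c U X _ _ smX _) _ => //.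
by rewrite fgE //; exact: YD.
Qed.

End AffineTransfer.

Section Coordinates.
Context {R : realType}.
Implicit Types (r s : 'rV[R]_6) (i : 'I_3).

Lemma val_xidx i : xidx i = i.*2 :> nat.
Proof. by rewrite inordK //; case: i => -[|[|[|//]]]. Qed.

Lemma val_yidx i : yidx i = i.*2.+1 :> nat.
Proof. by rewrite inordK //; case: i => -[|[|[|//]]]. Qed.

Lemma row6P r s : (forall i, xc r i = xc s i) -> (forall i, yc r i = yc s i) -> r = s.
Proof.
move=> X Y; apply/rowP => j; have lt3 : (j./2 < 3)%N by case: j => -[|[|[|[|[|[|//]]]]]].
pose i := Ordinal lt3.
have [jo|je] := boolP (odd j).
  have -> : j = yidx i by apply/ord_inj; rewrite val_yidx /= -[LHS]odd_double_half jo.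
  exact: Y.
have -> : j = xidx i by apply/ord_inj; rewrite val_xidx /= -[LHS]odd_double_half (negbTE je).
exact: X.
Qed.

Lemma xc_row (t : seq R) i : xc (\row_j t`_j) i = t`_(i.*2).
Proof. by rewrite /xc mxE val_xidx. Qed.

Lemma yc_row (t : seq R) i : yc (\row_j t`_j) i = t`_(i.*2.+1).
Proof. by rewrite /yc mxE val_yidx. Qed.

Lemma xc_lin a r s i : xc (a *: r + s) i = a * xc r i + xc s i.
Proof. by rewrite /xc !mxE. Qed.

Lemma yc_lin a r s i : yc (a *: r + s) i = a * yc r i + yc s i.
Proof. by rewrite /yc !mxE. Qed.

Lemma xcZ a r i : xc (a *: r) i = a * xc r i. Proof. by rewrite /xc mxE. Qed.
Lemma ycZ a r i : yc (a *: r) i = a * yc r i. Proof. by rewrite /yc mxE. Qed.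
Lemma xcB r s i : xc (r - s) i = xc r i - xc s i. Proof. by rewrite /xc !mxE. Qed.
Lemma ycB r s i : yc (r - s) i = yc r i - yc s i. Proof. by rewrite /yc !mxE. Qed.

Lemma xc_Z i j r : xc (Z i r) j = (i == j)%:R * (xc r (i + 1) - xc r (i + 2)).
Proof.
rewrite {1}/xc /Z !mxE eqxx /= mulrC.
have -> : (xidx j == yidx i) = false.
  by apply/eqP => /(congr1 (@nat_of_ord 6));
    rewrite val_xidx val_yidx => /(congr1 odd) /=; rewrite !odd_double.
have -> : (xidx j == xidx i) = (i == j).
  by rewrite -(inj_eq (@ord_inj 6)) !val_xidx (inj_eq double_inj) eq_sym.
by rewrite mulr0 addr0.
Qed.

Lemma yc_Z i j r : yc (Z i r) j = (i == j)%:R * (yc r (i + 1) - yc r (i + 2)).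
Proof.
rewrite {1}/yc /Z !mxE eqxx /= [in RHS]mulrC.
have -> : (yidx j == xidx i) = false.
  by apply/eqP => /(congr1 (@nat_of_ord 6));
    rewrite val_xidx val_yidx => /(congr1 odd) /=; rewrite !odd_double.
have -> : (yidx j == yidx i) = (i == j).
  by rewrite -(inj_eq (@ord_inj 6)) !val_yidx eqSS (inj_eq double_inj) eq_sym.
by rewrite mulr0 add0r.
Qed.

Lemma Z_linear i : linear (@Z R i).
Proof.
by move=> a r s; apply: row6P => j;
  rewrite ?(xc_lin, yc_lin, xc_Z, yc_Z); ring.
Qed.

Lemma signed_areaE r : signed_area r = 2^-1 *
  ((yc r 0 * xc r 1 - xc r 0 * yc r 1) + (yc r 1 * xc r 2 - xc r 1 * yc r 2)
   + (yc r 2 * xc r 0 - xc r 2 * yc r 0)).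
Proof.
rewrite /signed_area sum3.
have -> : (0 + 1 : 'I_3) = 1 by exact/val_inj.
have -> : (1 + 1 : 'I_3) = 2 by exact/val_inj.
by have -> : (2 + 1 : 'I_3) = 0 by exact/val_inj.
Qed.

End Coordinates.

HB.instance Definition _ (R : realType) (i : 'I_3) :=
  GRing.isLinear.Build R 'rV[R]_6 'rV[R]_6 _ (@Z R i) (@Z_linear R i).

Section Ants.
Context {R : realType} (A : R).
Hypothesis A0 : A != 0.

(* The columns of to_affine r + e_33 are r_1 - r_3, r_2 - r_3 and r_3, with first
   coordinates rescaled so that triangles of area A go to matrices of determinant 1. *)
Definition to_affine (r : 'rV[R]_6) : 'M[R]_3 :=
  let s := - (2 * A)^-1 in
  \matrix_(i, j) nth 0 (nth [::]
    [:: [:: s * (xc r 0 - xc r 2); s * (xc r 1 - xc r 2); s * xc r 2];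
        [:: yc r 0 - yc r 2; yc r 1 - yc r 2; yc r 2]] i) j.

Definition of_affine (h : 'M[R]_3) : 'rV[R]_6 :=
  let s := - (2 * A) in
  \row_j [:: s * (h 0 0 + h 0 2); h 1 0 + h 1 2; s * (h 0 1 + h 0 2); h 1 1 + h 1 2;
             s * h 0 2; h 1 2]`_j.

Fact to_affine_linear : linear to_affine.
Proof.
move=> a r t; apply/matrixP; do 2!elim/ord3P; rewrite !mxE /= ?(xc_lin, yc_lin); ring.
Qed.

Fact of_affine_linear : linear of_affine.
Proof.
move=> a h k; apply: row6P; elim/ord3P; rewrite ?(xc_lin, yc_lin) ?(xc_row, yc_row) /= !mxE; ring.
Qed.

HB.instance Definition _ := GRing.isLinear.Build R _ _ _ to_affine to_affine_linear.
HB.instance Definition _ := GRing.isLinear.Build R _ _ _ of_affine of_affine_linear.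

Local Notation e33 := (delta_mx 2 2 : 'M[R]_3).

Lemma to_affineK : cancel to_affine of_affine.
Proof.
move=> r; have A2 : 2 * A != 0 by rewrite mulf_neq0.
by apply: row6P; elim/ord3P; rewrite ?(xc_row, yc_row) /= !mxE /=; field.
Qed.

Lemma of_affineK (h : 'M[R]_3) : h 2 0 = 0 -> h 2 1 = 0 -> h 2 2 = 0 ->
  to_affine (of_affine h) = h.
Proof.
move=> h20 h21 h22.
by apply/matrixP; do 2!elim/ord3P; rewrite !mxE /= ?(xc_row, yc_row) /= ?h20 ?h21 ?h22 //; field.
Qed.

Lemma of_affine_e33 : of_affine e33 = 0.
Proof. by apply: row6P; elim/ord3P; rewrite ?(xc_row, yc_row) /= /xc /yc !mxE /=; ring. Qed.

Lemma to_affine_mem r : triangles A r -> SL2R2 (to_affine r + e33).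
Proof.
rewrite /triangles /= signed_areaE => rA; split; rewrite !mxE /=; try ring.
rewrite -rA; field.
by move: A0; rewrite -rA mulf_eq0 negb_or => /andP [].
Qed.

Lemma of_affineKe (h : 'M[R]_3) : SL2R2 h -> to_affine (of_affine h) + e33 = h.
Proof.
move=> [h20 h21 h22 _]; apply: (addIr (- e33)); rewrite addrK.
have <- : of_affine (h - e33) = of_affine h.
  by rewrite [LHS](linearB (of_affine : {linear _ -> _})) /= of_affine_e33 subr0.
by rewrite of_affineK // !mxE ?h20 ?h21 ?h22 /=; ring.
Qed.

Lemma of_affine_mem (h : 'M[R]_3) : SL2R2 h -> triangles A (of_affine h).
Proof.
move=> [_ _ _ dh]; rewrite /triangles /= signed_areaE !(xc_row, yc_row) /=.
transitivity (A * (h 0 0 * h 1 1 - h 0 1 * h 1 0)); last by rewrite dh mulr1.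
by field.
Qed.

Lemma to_affine_Z01 r : to_affine (Z 0 r - Z 1 r) = (to_affine r + e33) *m aff 1 1 0 0 0.
Proof.
have [[m00 m01 m02] [[m10 m11 m12] [m20 m21 m22]]] := @affE R 1 1 0 0 0.
have i1 : (0 + 1 : 'I_3) = 1 by exact/val_inj.
have i2 : (1 + 1 : 'I_3) = 2 by exact/val_inj.
have i3 : (0 + 2 : 'I_3) = 2 by exact/val_inj.
have i4 : (1 + 2 : 'I_3) = 0 by exact/val_inj.
by apply/matrixP; do 2!elim/ord3P; rewrite mulmx3E ?(m00, m01, m02, m10, m11, m12, m20, m21, m22)
  !mxE /= ?(xcB, ycB, xc_Z, yc_Z) /= ?(i1, i2, i3, i4); ring.
Qed.

Lemma to_affine_Z20 r : to_affine (Z 2 r - Z 0 r) = - ((to_affine r + e33) *m aff 1 0 1 (-1) 1).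
Proof.
have [[m00 m01 m02] [[m10 m11 m12] [m20 m21 m22]]] := @affE R 1 0 1 (-1) 1.
have i1 : (0 + 1 : 'I_3) = 1 by exact/val_inj.
have i2 : (2 + 1 : 'I_3) = 0 by exact/val_inj.
have i3 : (0 + 2 : 'I_3) = 2 by exact/val_inj.
have i4 : (2 + 2 : 'I_3) = 1 by exact/val_inj.
by apply/matrixP; do 2!elim/ord3P; rewrite [RHS]mxE mulmx3E ?(m00, m01, m02, m10, m11, m12, m20, m21, m22)
  !mxE /= ?(xcB, ycB, xc_Z, yc_Z) /= ?(i1, i2, i3, i4); ring.
Qed.

Lemma mem_span2 (V : vectType R) (v1 v2 w : V) :
  w \in span [:: v1; v2] <-> exists a b, w = a *: v1 + b *: v2.
Proof.
split=> [/mem_spanP [k ->]|[a [b ->]]].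
  by exists (k 0%N), (k 1%N); rewrite sum_nth_ord /= !big_cons big_nil addr0.
by rewrite memvD // memvZ // memv_span // !inE eqxx ?orbT.
Qed.

Lemma pushes_ant : pushes (triangles A) (to_affine : {linear _ -> _}) e33 ant_distribution MC_distribution.
Proof.
move=> r rA; rewrite MC_distributionE; last exact: to_affine_mem.
apply/seteqP; split=> [_ [v + <-]|_ [K + ->]]; rewrite /ant_distribution /vset /=.
  move=> /mem_span2 [a [b ->]]; exists (a *: aff 1 1 0 0 0 - b *: aff 1 0 1 (-1) 1).
    by apply/mem_span2; exists a, (- b); rewrite scaleNr.
  rewrite linearD !linearZ /= to_affine_Z01 to_affine_Z20.
  by rewrite mulmxDr -!scalemxAr mulmxN.
move=> /mem_span2 [a [b ->]]; exists (a *: (Z 0 r - Z 1 r) - b *: (Z 2 r - Z 0 r)).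
  by apply/mem_span2; exists a, (- b); rewrite scaleNr.
rewrite linearB !linearZ /= to_affine_Z01 to_affine_Z20.
by rewrite opprK mulmxDr -!scalemxAr.
Qed.

Definition area_form (r v : 'rV[R]_6) : R := 2^-1 *
  ((yc v 0 * xc r 1 + yc r 0 * xc v 1 - (xc v 0 * yc r 1 + xc r 0 * yc v 1)) +
   (yc v 1 * xc r 2 + yc r 1 * xc v 2 - (xc v 1 * yc r 2 + xc r 1 * yc v 2)) +
   (yc v 2 * xc r 0 + yc r 2 * xc v 0 - (xc v 2 * yc r 0 + xc r 2 * yc v 0))).

Lemma signed_area_fun : @signed_area R = 2^-1 *:
  ((((fun r => yc r 0 * xc r 1) - (fun r => xc r 0 * yc r 1)) +
    ((fun r => yc r 1 * xc r 2) - (fun r => xc r 1 * yc r 2))) +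
    ((fun r => yc r 2 * xc r 0) - (fun r => xc r 2 * yc r 0))).
Proof. by apply/funext => r; rewrite signed_areaE. Qed.

Lemma is_diff_signed_area r : is_diff r (@signed_area R) (area_form r).
Proof.
pose P (i j : 'I_3) := is_diff_mxcoordM 0 (yidx i) 0 (xidx j) r.
pose Q (i j : 'I_3) := is_diff_mxcoordM 0 (xidx i) 0 (yidx j) r.
have H := is_diffZ (2^-1) (is_diffD (is_diffD (is_diffB (P 0 1) (Q 0 1)) (is_diffB (P 1 2) (Q 1 2)))
  (is_diffB (P 2 0) (Q 2 0))).
have -> : @signed_area R = _ := signed_area_fun.
exact: H.
Qed.

Lemma Ck_signed_area k (O : set 'rV[R]_6) : open O -> Ck k O (@signed_area R).
Proof.
move=> oO; rewrite signed_area_fun; apply: CkZ => //.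
by apply: CkD => //; [apply: CkD => //|]; apply: CkB => //; exact: Ck_mxcoordM.
Qed.

Lemma submanifold_triangles : submanifold 5 (triangles A).
Proof.
move=> p pA; exists 1%N, [set r | signed_area r != 0], (fun r => \row_(j < 1) (signed_area r - A)).
have oU : open [set r : 'rV[R]_6 | signed_area r != 0].
  by apply: open_neq0 => r; apply: differentiable_continuous; case: (is_diff_signed_area r).
have dF r : is_diff r (fun r => signed_area r - A) (area_form r).
  exact/is_diffBc/is_diff_signed_area.
split=> //.
- by rewrite /= pA.
- split=> // k; apply: (Ck_row (f := fun _ r => signed_area r - A)) => // _.
  by apply: (CkB (g := fun _ => A)) => //; [exact: Ck_signed_area|exact: Ck_cst].
- move=> q /= q0 w; exists ((w 0 0 / (2 * signed_area q)) *: q).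
  have dq : differentiable (fun r => signed_area r - A) q by case: (dF q).
  apply: etrans (diff_row (f := fun _ r => signed_area r - A) (fun=> dq) _) _.
  apply/rowP => j; rewrite mxE ord1.
  have [_ /(congr1 (fun f => f ((w 0 0 / (2 * signed_area q)) *: q))) e] := dF q.
  apply: etrans e _; transitivity (2 * (w 0 0 / (2 * signed_area q)) * signed_area q); last by field.
  move: (w 0 0 / (2 * signed_area q)) => k.
  by rewrite /area_form !(xcZ, ycZ) signed_areaE; ring.
- move=> q _; split=> [qA|/rowP /(_ 0)].
    by apply/rowP => j; rewrite !mxE qA subrr.
  by rewrite !mxE => /eqP; rewrite subr_eq0 => /eqP.
Qed.

Lemma to_affine_SL2R2 x : triangles A x -> SL2R2 ((to_affine : {linear _ -> _}) x + e33).
Proof. exact: to_affine_mem. Qed.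

Lemma of_affine_triangles y : SL2R2 y -> triangles A ((of_affine : {linear _ -> _}) y + 0).
Proof. by rewrite addr0; exact: of_affine_mem. Qed.

Lemma of_affine_to_affine x : of_affine (to_affine x + e33) + 0 = x.
Proof.
have -> : of_affine (to_affine x + e33) = of_affine (to_affine x) + of_affine e33.
  exact: (linearD (of_affine : {linear _ -> _})).
by rewrite to_affineK of_affine_e33 !addr0.
Qed.

Lemma to_affine_of_affine y : SL2R2 y -> to_affine (of_affine y + 0) + e33 = y.
Proof. by rewrite addr0; exact: of_affineKe. Qed.

Lemma of_affineK_lmulset (h w : 'M[R]_3) (L : {vspace 'M[R]_3}) : SL2R2 h -> (forall K, K \in L -> sl2r2 K) ->
  lmulset h (vset L) w -> to_affine (of_affine w) = w.
Proof.
move=> [h20 h21 h22 _] Lg [K /Lg [k20 k21 k22 _] ->].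
by apply: of_affineK; rewrite mulmx3E h20 h21 h22 ?k20 ?k21 ?k22; ring.
Qed.

Lemma sl2r2_mc_basis2 (K : 'M[R]_3) : K \in span mc_basis2 -> sl2r2 K.
Proof. by move=> /mem_mc_basis2 [b [c ->]]; exact: sl2r2_aff. Qed.

Lemma sl2r2_mc_basis3 (K : 'M[R]_3) : K \in span mc_basis3 -> sl2r2 K.
Proof. by move=> /mem_mc_basis3 [a [b [c ->]]]; exact: sl2r2_aff. Qed.

Lemma sl2r2_mc_basis5 (K : 'M[R]_3) : K \in span mc_basis5 -> sl2r2 K.
Proof. by move=> /mem_mc_basis5 [a [b [c [d [e ->]]]]]; exact: sl2r2_aff. Qed.

Lemma of_affineK0 h w : SL2R2 h -> MC_distribution h w -> to_affine (of_affine w) = w.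
Proof.
by move=> hG; rewrite MC_distributionE //; apply: of_affineK_lmulset => // K; exact: sl2r2_mc_basis2.
Qed.

Lemma of_affineK1 h w : SL2R2 h -> derived (@SL2R2 R) MC_distribution h w ->
  to_affine (of_affine w) = w.
Proof.
by move=> hG; rewrite derived_MC1 //; apply: of_affineK_lmulset => // K; exact: sl2r2_mc_basis3.
Qed.

Lemma of_affineK2 h w : SL2R2 h ->
  derived (@SL2R2 R) (derived (@SL2R2 R) MC_distribution) h w -> to_affine (of_affine w) = w.
Proof.
by move=> hG; rewrite derived_MC2 //; apply: of_affineK_lmulset => // K; exact: sl2r2_mc_basis5.
Qed.

Lemma rank_ant0 r : triangles A r -> has_rank (ant_distribution r) 2.
Proof.
move=> rA; have rG := to_affine_SL2R2 rA.
have [_ _ /(_ _ rG) [rk _ _]] := @is_235_MC R.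
apply: (has_rank_affine (g := of_affine) to_affineK pushes_ant rA) rk => w.
exact: of_affineK0.
Qed.

Lemma is_distribution_ant : is_distribution (triangles A) 2 ant_distribution.
Proof.
split=> [r rA v vD|r rA].
  apply: (tangent_affine of_affine_triangles (fun x _ => of_affine_to_affine x) to_affineK _ rA).
  have : MC_distribution (to_affine r + e33) (to_affine v) by rewrite -pushes_ant //; exists v.
  by case.
pose X (i : 'I_2) (q : 'rV[R]_6) : 'rV[R]_6 := if i == 0 then Z 0 q - Z 1 q else Z 2 q - Z 0 q.
have smZ (i j : 'I_3) : smooth_on setT (fun q => Z i q - Z j q : 'rV[R]_6).
  have := smooth_affine (Z i \- Z j : {linear 'rV[R]_6 -> 'rV[R]_6}) 0.
  by congr smooth_on; apply/funext => q; rewrite addr0.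
exists setT, X; split=> // [i|q qA _].
  rewrite /X; case: (i == 0); exact: smZ.
have -> : [seq X i q | i : 'I_2] = [:: Z 0 q - Z 1 q; Z 2 q - Z 0 q].
  by rewrite /image_mem enum_ordSl enum_ordSl enum_ord0.
by split=> //; apply: free_of_rank; exact: rank_ant0.
Qed.

Lemma is_235_ant : is_235 (triangles A) ant_distribution.
Proof.
split; [exact: submanifold_triangles|exact: is_distribution_ant|move=> r rA].
have rG := to_affine_SL2R2 rA; have [_ _ /(_ _ rG) [_ rk1 rk2]] := @is_235_MC R.
have push1 : pushes (triangles A) (to_affine : {linear _ -> _}) e33
    (derived (triangles A) ant_distribution) (derived (@SL2R2 R) MC_distribution).
  apply: (pushes_derived to_affine_SL2R2 of_affine_triangles (fun x _ => of_affine_to_affine x) to_affine_of_affine to_affineK pushes_ant).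
  by move=> y w; exact: of_affineK1.
have push2 : pushes (triangles A) (to_affine : {linear _ -> _}) e33
    (derived (triangles A) (derived (triangles A) ant_distribution))
    (derived (@SL2R2 R) (derived (@SL2R2 R) MC_distribution)).
  apply: (pushes_derived to_affine_SL2R2 of_affine_triangles (fun x _ => of_affine_to_affine x) to_affine_of_affine to_affineK push1).
  by move=> y w; exact: of_affineK2.
split; first exact: rank_ant0.
  apply: (has_rank_affine (g := of_affine) to_affineK push1 rA) rk1 => w.
  exact: of_affineK1.
apply: (has_rank_affine (g := of_affine) to_affineK push2 rA) rk2 => w.
exact: of_affineK2.
Qed.

Lemma ant_equivalent_MC :
  locally_equivalent (triangles A) ant_distribution (@SL2R2 R) MC_distribution.
Proof.
move=> p pA; exists (to_affine p + e33); split; first exact: to_affine_SL2R2.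
exists setT, setT, (fun x => to_affine x + e33), (fun y => of_affine y + 0); split; split=> //.
- exact: (smooth_affine (to_affine : {linear _ -> _})).
- exact: (smooth_affine (of_affine : {linear _ -> _})).
- by move=> x xA _; split=> //; [exact: to_affine_SL2R2|exact: of_affine_to_affine].
- by move=> y yG _; split=> //; [exact: of_affine_triangles|exact: to_affine_of_affine].
- move=> x xA _; rewrite -(pushes_ant xA); apply: eq_imagel => v _.
  by have [_ e] := is_diff_affine (to_affine : {linear _ -> _}) e33 x; exact: (congr1 (fun f => f v) e).
Qed.

End Ants.

Theorem proposition6p1 (R : realType) (A : R) (hA : A != 0) :
  is_235 (triangles A) ant_distribution /\
  is_235 (@SL2R2 R) MC_distribution /\
  homogeneous (@SL2R2 R) MC_distribution /\
  locally_equivalent (triangles A) ant_distribution (@SL2R2 R) MC_distribution.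
Proof.
split; first exact: is_235_ant.
split; first exact: is_235_MC.
split; [exact: homogeneous_MC|exact: ant_equivalent_MC].
Qed.
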